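(* Let $N\in\mathbb{N}$, $N\ge 1$, let $\Omega\subseteq\mathbb{R}$ be a bounded open interval and let $\mathscr{L}:\overline{\Omega}\times\mathbb{R}^N\times\mathbb{R}^N\longrightarrow[0,\infty)$, $(x,\eta,P)\mapsto\mathscr{L}(x,\eta,P)$, be a continuous function. Assume that: (1) For each $(x,\eta)\in\overline{\Omega}\times\mathbb{R}^N$, the function $P\mapsto\mathscr{L}(x,\eta,P)$ is level-convex, that is, for each $t\ge 0$ the sublevel set $$\{P\in\mathbb{R}^N : \mathscr{L}(x,\eta,P)\le t\}$$ is a convex subset of $\mathbb{R}^N$. (2) There exist constants $C_1>0$, $C_2\ge 0$, $C_3\ge 0$ and $0<q\le r<+\infty$, and a locally bounded function $h:\mathbb{R}\times\mathbb{R}^N\longrightarrow[0,+\infty)$ such that for all $(x,\eta,P)\in\overline{\Omega}\times\mathbb{R}^N\times\mathbb{R}^N$ $$C_1|P|^q-C_2\,\le\,\mathscr{L}(x,\eta,P)\,\le\,h(x,\eta)|P|^r+C_3 .$$ Then, for any affine map $b:\mathbb{R}\longrightarrow\mathbb{R}^N$, there exists a map $u^\infty\in W^{1,\infty}_b(\Omega,\mathbb{R}^N)$ which is a vectorial Absolute Minimiser of the supremal functional $$E_\infty(u,\Omega')\,:=\,\underset{x\in\Omega'}{\mathrm{ess\,sup}}\ \mathscr{L}\big(x,u(x),\mathrm{D}u(x)\big),\qquad u\in W^{1,\infty}_{\mathrm{loc}}(\Omega,\mathbb{R}^N),\ \ \Omega'\Subset\Omega,$$ that is, $$E_\infty(u^\infty,\Omega')\,\le\,E_\infty(u^\infty+\phi,\Omega')\qquad\text{for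 all } \Omega'\Subset\Omega \text{ and all } \phi\in W^{1,\infty}_0(\Omega',\mathbb{R}^N).$$
   Context: $\mathrm{D}u$ denotes the (weak, equivalently a.e.) derivative of $u:\Omega\subseteq\mathbb{R}\to\mathbb{R}^N$, and $|\cdot|$ is the Euclidean norm. $\Omega'\Subset\Omega$ means that $\Omega'$ is an open set whose closure is a compact subset of $\Omega$. For a bounded open set $U\subseteq\mathbb{R}$, $W^{1,\infty}_0(U,\mathbb{R}^N)$ is the space of maps in $W^{1,\infty}(U,\mathbb{R}^N)$ vanishing on $\partial U$ (i.e. $W^{1,\infty}(U,\mathbb{R}^N)\cap W^{1,1}_0(U,\mathbb{R}^N)$). For an affine map $b:\mathbb{R}\to\mathbb{R}^N$, $W^{1,\infty}_b(\Omega,\mathbb{R}^N):=b+W^{1,\infty}_0(\Omega,\mathbb{R}^N)$, i.e. the maps in $W^{1,\infty}(\Omega,\mathbb{R}^N)$ which agree with $b$ at the endpoints of $\Omega$. *)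

(* Defs.v *)
From HB Require Import structures.
From mathcomp Require Export all_boot all_order all_algebra.
From mathcomp Require Export all_classical all_reals all_analysis.
From mathcomp Require Export ess_sup_inf.
Export Order.TTheory GRing.Theory Num.Theory.
Export numFieldNormedType.Exports.

Set Implicit Arguments.
Unset Strict Implicit.
Unset Printing Implicit Defensive.

Local Open Scope classical_set_scope.
Local Open Scope ring_scope.

(* The library norm on 'rV[R]_N is the sup norm; it induces the same topology,
   but growth conditions are stated with the Euclidean norm. *)
Definition eucl_norm (R : realType) (N : nat) (v : 'rV[R]_N) : R :=
  Num.sqrt (\sum_(i < N) v 0 i ^+ 2).

(* Extending by -oo outside U makes this the essential supremum for the
   restriction of the Lebesgue measure to U (so it is -oo when U is null). *)
Definition ess_sup_on (R : realType) (U : set R) (f : R -> \bar R) : \bar R :=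
  ess_sup (@lebesgue_measure R) (patch (cst -oo%E) U f).

(* As in one-dimensional Sobolev theory (e.g. Brezis, Ch. 8), test functions
   are taken in C^1_c(U). *)
Definition test_function (R : realType) (U : set R) (phi : R -> R) : Prop :=
  [/\ forall x, derivable phi x 1,
      continuous (derive1 phi),
      compact (closure [set x | phi x != 0]) &
      closure [set x | phi x != 0] `<=` U].

Definition weak_derivative (R : realType) (N : nat) (U : set R)
    (u g : R -> 'rV[R]_N) : Prop :=
  forall i : 'I_N,
    [/\ locally_integrable U (fun x => u x 0 i),
        locally_integrable U (fun x => g x 0 i) &
        forall phi, test_function U phi ->
          \int[lebesgue_measure]_(x in U) (u x 0 i * derive1 phi x)
          = - \int[lebesgue_measure]_(x in U) (g x 0 i * phi x)].

(* Weak derivatives on U are unique up to a null set, and Dw is only used where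
   the chosen representative is irrelevant. *)
Definition Dw (R : realType) (N : nat) (U : set R) (u : R -> 'rV[R]_N) :
    R -> 'rV[R]_N :=
  xget (cst 0) [set g | weak_derivative U u g].

(* Elements of function spaces on U are represented by total functions on R,
   whose values outside U (and on null subsets of U) play no role. *)
Definition Loo (R : realType) (N : nat) (U : set R) : set (R -> 'rV[R]_N) :=
  [set u : R -> 'rV[R]_N |
     (forall i : 'I_N, measurable_fun U (fun x => u x 0 i)) /\
     (ess_sup_on U (fun x => (eucl_norm (u x))%:E) < +oo)%E].

Definition W1oo (R : realType) (N : nat) (U : set R) : set (R -> 'rV[R]_N) :=
  [set u : R -> 'rV[R]_N | Loo U u /\ exists2 g, weak_derivative U u g & Loo U g].

(* Boundary values are those of the representative continuous up to the
   boundary; for open U the boundary of U is closure U `\` U. *)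
Definition W1oo0 (R : realType) (N : nat) (U : set R) : set (R -> 'rV[R]_N) :=
  [set u : R -> 'rV[R]_N |
     W1oo U u /\ exists v : R -> 'rV[R]_N,
     [/\ {ae lebesgue_measure, forall x, U x -> v x = u x},
         {within closure U, continuous v} &
         forall x, (closure U `\` U) x -> v x = 0]].

Definition W1oo_bd (R : realType) (N : nat) (b : R -> 'rV[R]_N) (U : set R) :
    set (R -> 'rV[R]_N) :=
  [set u : R -> 'rV[R]_N | exists2 phi, W1oo0 U phi & u = b \+ phi].

Definition affine_map (R : realType) (N : nat) (b : R -> 'rV[R]_N) : Prop :=
  exists c d : 'rV[R]_N, forall x, b x = c + x *: d.

Definition compactly_in (R : realType) (U' U : set R) : Prop :=
  [/\ open U', compact (closure U') & closure U' `<=` U].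

Definition level_convex (R : realType) (N : nat) (f : 'rV[R]_N -> R) : Prop :=
  forall t : R, 0 <= t ->
    convex_set ([set P | f P <= t] : set (convex_lmodType 'rV[R]_N)).

Definition locally_bounded (R : realType) (T : topologicalType) (h : T -> R) :
    Prop :=
  forall z : T, bounded_near (h : T -> R^o) (nbhs z).

Definition Einf (R : realType) (N : nat)
    (L : R -> 'rV[R]_N -> 'rV[R]_N -> R) (u : R -> 'rV[R]_N) (U' : set R) :
    \bar R :=
  ess_sup_on U' (fun x => (L x (u x) (Dw U' u x))%:E).

(* Only the values on U' enter Einf _ U', so phi need not be extended by 0. *)
Definition absolute_minimiser (R : realType) (N : nat)
    (L : R -> 'rV[R]_N -> 'rV[R]_N -> R) (U : set R) (u : R -> 'rV[R]_N) :
    Prop :=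
  forall U' : set R, compactly_in U' U ->
  forall phi : R -> 'rV[R]_N, W1oo0 U' phi ->
    (Einf L u U' <= Einf L (u \+ phi)%R U')%E.

(* Main.v *)
Require Import Defs.
From HB Require Import structures.
From mathcomp Require Import ring lra measurable_realfun.

(* Replace the essential supremum of L(x, u, Du) on [x, y] by a bound on
   L(s, u s, (u s' - u s) / (s' - s)) up to an error that vanishes as s' - s -> 0.
   Since averages of Du stay in closed convex sets, level-convexity makes this
   "slope energy" equal to the essential supremum, and it passes to pointwise
   limits.  On a grid of n cells, minimise up to an error 1, among paths from
   b(alpha) to b(beta), the sum over the cells of (1 + cell energy)^(n^2).  By
   Bernoulli, n + 1 <= (1 + 1/n)^(n^2), so the minimiser u_n beats every
   competitor with the same values at two grid points up to a factor 1 + 1/n in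
   1 + energy.  Coercivity makes the u_n equi-Lipschitz; their limit along an
   ultrafilter minimises on every subinterval, a competitor being first joined to
   u_n by a small affine correction.  For an open set, argue on each component.
   Weak derivatives are handled through the fundamental theorem of calculus, and
   those of Lipschitz functions are obtained from Radon-Nikodym. *)

Set Implicit Arguments.
Unset Strict Implicit.
Unset Printing Implicit Defensive.

Local Open Scope classical_set_scope.
Local Open Scope ring_scope.

(** * Slopes and slope energy *)

Section slope.
Context {R : realType} {V : normedModType R}.
Implicit Types (u w : R -> V) (K : set V).

(** The obstacle is that minimising a supremum over the whole interval says nothing about
    subintervals on which the integrand stays below its maximum. A sum over cells is local:
    exchanging the minimiser for a competitor between two grid points leaves the other terms alone.
    A high power makes the sum behave like a maximum, and an exponent quadratic in the number of
    cells outweighs that number. Integrating powers of L along Du would lose lower semicontinuity,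
    since powers of a level-convex function need not be convex; here each cell carries a supremum
    instead. No minimiser on the grid has to exist: every term of the sum is at least 1, so an
    additive error 1 costs no more than one further cell. Dimension one enters in that an interval
    has two boundary points, whose values an affine map can correct, and in that open sets split
    into countably many intervals. *)

Definition slope u (s s' : R) : V := (s' - s)^-1 *: (u s' - u s).

Definition cvx_set K := forall (k : R) P Q, 0 <= k <= 1 -> K P -> K Q ->
  K (k *: P + (1 - k) *: Q).

Lemma slope_split u s m s' : s < m -> m < s' ->
  slope u s s' = ((m - s) / (s' - s)) *: slope u s m
               + (1 - (m - s) / (s' - s)) *: slope u m s'.
Proof.
move=> sm ms'; rewrite /slope !scalerA.
have -> : (m - s) / (s' - s) / (m - s) = (s' - s)^-1 by field; lra.
have -> : (1 - (m - s) / (s' - s)) / (s' - m) = (s' - s)^-1 by field; lra.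
by rewrite -scalerDr [in RHS](addrC (u m - u s)) subrKA.
Qed.

Lemma slope_cvx K u s m s' : cvx_set K -> s < m -> m < s' ->
  K (slope u s m) -> K (slope u m s') -> K (slope u s s').
Proof.
move=> cK sm ms' K1 K2; rewrite (slope_split u sm ms'); apply: cK => //.
rewrite divr_ge0; try lra.
by rewrite ler_pdivrMr; lra.
Qed.

(** A slope is a convex combination of the slopes over the two halves of its interval, so halving
    until the length is below [d] carries a convex constraint from small scales to all scales. *)
Lemma slope_bisect K u x y d : cvx_set K -> 0 < d ->
  (forall s s', x <= s -> s < s' -> s' <= y -> s' - s < d -> K (slope u s s')) ->
  forall s s', x <= s -> s < s' -> s' <= y -> K (slope u s s').
Proof.
move=> cK d0 H s s' xs ss' s'y.
have [n hn] : exists n : nat, s' - s < 2 ^+ n * d.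
  have /archi_boundP : 0 <= (s' - s) / d by rewrite divr_ge0; lra.
  set n := Num.bound _ => hn; exists n; rewrite -ltr_pdivrMr//.
  by apply: lt_le_trans hn _; rewrite -natrX ler_nat ltnW// ltn_expl.
elim: n s s' xs ss' s'y hn => [|n IH] s s' xs ss' s'y hn.
  by apply: H => //; move: hn; rewrite expr0 mul1r.
move: hn; rewrite exprS => hn.
apply: (@slope_cvx K u s ((s + s') / 2)) => //; try lra; apply: IH; lra.
Qed.

Lemma cvx_ball M : cvx_set [set P : V | `|P| <= M].
Proof.
move=> k P Q /andP[k0 k1] /= PM QM; apply: le_trans (ler_normD _ _) _.
by rewrite !normrZ (ger0_norm k0) ger0_norm; nra.
Qed.

Lemma slope_norm u M s s' : s < s' -> `|slope u s s'| <= M <-> `|u s' - u s| <= M * (s' - s).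
Proof.
move=> ss'; have ? : 0 < s' - s by lra.
rewrite /slope normrZ ger0_norm; last by rewrite invr_ge0 ltW.
by rewrite ler_pdivrMl// (mulrC M).
Qed.

Lemma slope_affine u (c : V) (d : V) w s s' : s < s' ->
  (forall z, z \in [:: s; s'] -> w z = u z + (c + z *: d)) ->
  slope w s s' = slope u s s' + d.
Proof.
move=> ss' h; rewrite /slope !h ?inE ?eqxx ?orbT//.
have -> : u s' + (c + s' *: d) - (u s + (c + s *: d)) = (u s' - u s) + (s' - s) *: d.
  rewrite scalerBl opprD addrACA; congr (_ + _).
  by rewrite opprD addrACA subrr add0r.
by rewrite scalerDr scalerA mulVf ?scale1r//; lra.
Qed.

Lemma slope_cvg (T : Type) (F : set_system T) {FF : Filter F} (f : T -> R -> V) u s s' :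
  f n s @[n --> F] --> u s -> f n s' @[n --> F] --> u s' ->
  slope (f n) s s' @[n --> F] --> slope u s s'.
Proof. by move=> h1 h2; apply: cvgZl_tmp; apply: cvgB. Qed.

End slope.

(* [lag_unif] follows from [lag_continuous] when V is finite-dimensional; it is
   the form in which compactness of balls enters the energy estimates. *)
Record lagrangian {R : realType} {V : normedModType R} (L : R -> V -> V -> R) : Prop := {
  lag_ge0 : forall x a P, 0 <= L x a P ;
  lag_convex : forall (x : R) a (t : R), cvx_set [set P | L x a P <= t] ;
  lag_coercive : forall T : R, exists2 M : R, 0 <= M &
    forall x a P, L x a P <= T -> `|P| <= M ;
  lag_unif : forall B e : R, 0 < e -> exists2 d : R, 0 < d &
    forall s s' a a' P P', `|s| <= B -> `|a| <= B -> `|P| <= B ->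
      `|s - s'| < d -> `|a - a'| < d -> `|P - P'| < d ->
      `|L s a P - L s' a' P'| < e ;
  lag_continuous : continuous (fun z : R * V * V => L z.1.1 z.1.2 z.2) }.

Section energy.
Context {R : realType} {V : normedModType R} (L : R -> V -> V -> R).
Implicit Types (u w : R -> V) (x y t : R).

(** A relation rather than a number: only upper bounds [t] are compared, so no supremum has to exist
    or be finite. [L] is evaluated at the left end of the pair. Nothing is required of [u]
    beforehand; continuity will follow from coercivity. The condition is vacuous unless [x < y]. *)
Definition energy_le u x y t := forall e : R, 0 < e -> exists2 d : R, 0 < d &
  forall s s', x <= s -> s < s' -> s' <= y -> s' - s < d ->
    L s (u s) (slope u s s') <= t + e.

Lemma energy_leW u x y t t' : t <= t' -> energy_le u x y t -> energy_le u x y t'.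
Proof.
move=> tt' H e e0; have [d d0 Hd] := H e e0; exists d => // s s' xs ss' s'y sd.
by apply: le_trans (Hd s s' xs ss' s'y sd) _; rewrite lerD2r.
Qed.

Lemma energy_le_sub u x y x' y' t : x <= x' -> y' <= y ->
  energy_le u x y t -> energy_le u x' y' t.
Proof.
move=> xx' yy' H e e0; have [d d0 Hd] := H e e0; exists d => // s s' xs ss' s'y.
by apply: Hd => //; [exact: le_trans xs|exact: le_trans yy'].
Qed.

Lemma energy_le_eq u w x y t : (forall s, x <= s <= y -> u s = w s) ->
  energy_le u x y t -> energy_le w x y t.
Proof.
move=> uw H e e0; have [d d0 Hd] := H e e0; exists d => // s s' xs ss' s'y sd.
have := Hd s s' xs ss' s'y sd.
rewrite /slope !uw//; apply/andP; split; lra.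
Qed.

Lemma energy_le_lim u x y t : (forall e, 0 < e -> energy_le u x y (t + e)) ->
  energy_le u x y t.
Proof.
move=> H e e0; have [||d d0 Hd] := H (e/2) _ (e/2); try lra.
exists d => // s s' xs ss' s'y sd; have := Hd s s' xs ss' s'y sd; lra.
Qed.

Hypothesis HL : lagrangian L.
Let Lconvex := lag_convex HL.
Let Lcoer := lag_coercive HL.
Let Lunif := lag_unif HL.
Let Lcont := lag_continuous HL.

Lemma energy_le_ge0 u x y t : x < y ->
  energy_le u x y t -> 0 <= t.
Proof.
move=> xy H; apply/ler_addgt0Pr => e e0; have [d d0 Hd] := H e e0.
have m0 : 0 < Num.min d (y - x) by rewrite lt_min d0 subr_gt0.
have md : Num.min d (y - x) <= d by rewrite ge_min lexx.
have my : Num.min d (y - x) <= y - x by rewrite ge_min lexx orbT.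
apply: le_trans (Hd x (x + Num.min d (y - x) / 2) _ _ _ _); try lra.
exact: lag_ge0.
Qed.

Lemma L_lim_le (T : Type) (F : set_system T) {FF : ProperFilter F}
    (f : T -> R) (g h : T -> V) (s : R) (a P : V) (c : R) :
  f n @[n --> F] --> s -> g n @[n --> F] --> a -> h n @[n --> F] --> P ->
  (\forall n \near F, L (f n) (g n) (h n) <= c) -> L s a P <= c.
Proof.
move=> fs ga hP Hc.
have cv : L (f n) (g n) (h n) @[n --> F] --> L s a P.
  apply: (@cvg_comp _ _ _ (fun n => (f n, g n, h n)) _ F _ _ _ (@Lcont (s, a, P))).
  exact: (cvg_pair (cvg_pair fs ga) hP).
exact: (closed_cvg [set z | z <= c] (@closed_le _ c) Hc _ cv).
Qed.

(** At small scales [L] is at most [T + 1], so coercivity puts the slopes in a fixed ball, and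
    [slope_bisect] extends this to all pairs. [M] is chosen before [u], which makes a whole sequence
    equi-Lipschitz. *)
Lemma energy_lip T : exists2 M : R, 0 <= M & forall u x y t, t <= T ->
  energy_le u x y t ->
  forall s s', x <= s -> s <= s' -> s' <= y -> `|u s' - u s| <= M * (s' - s).
Proof.
have [M M0 HM] := Lcoer (T + 1); exists M => // u x y t tT H s s' xs.
rewrite le_eqVlt => /predU1P[<-|ss' s'y]; first by rewrite !subrr normr0 mulr0.
have [d d0 Hd] := H 1 ltr01.
apply/(slope_norm _ _ ss').
change ([set P : V | `|P| <= M] (slope u s s')).
apply: (slope_bisect (@cvx_ball _ _ M) d0 _ xs ss' s'y) => p q xp pq qy pqd.
by apply: (HM p (u p)); apply: le_trans (Hd p q xp pq qy pqd) _; rewrite lerD2r.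
Qed.

Lemma energy_bounded u x y t : energy_le u x y t ->
  exists B : R, forall s, x <= s <= y -> `|s| <= B /\ `|u s| <= B.
Proof.
have [M M0 HM] := energy_lip t => /(HM _ _ _ _ (lexx t)) H.
exists (`|x| + `|y| + `|u x| + M * `|y - x|) => s /andP[xs sy]; split.
  have := ler_norm y; have := ler_norm (- x); rewrite normrN => h1 h2.
  have := normr_ge0 (u x); have : 0 <= M * `|y - x| by rewrite mulr_ge0.
  have := normr_ge0 x; have := normr_ge0 y.
  by move=> *; rewrite ler_norml; apply/andP; split; lra.
have := H x s (lexx x) xs sy => h.
have : `|u s| <= `|u s - u x| + `|u x| by rewrite -{1}(subrK (u x) (u s)) ler_normD.
have : M * (s - x) <= M * `|y - x|.
  by apply: ler_wpM2l => //; apply: le_trans (ler_norm _); lra.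
have := normr_ge0 x; have := normr_ge0 y; lra.
Qed.

(* Freezing (s, u s) in the convex sublevel set makes the step size d uniform in u. *)
Lemma energy_unif T (B e : R) : 0 < e -> exists2 d : R, 0 < d & forall u x y t, t <= T ->
  (forall s, x <= s <= y -> `|s| <= B /\ `|u s| <= B) ->
  energy_le u x y t -> forall s s', x <= s -> s < s' -> s' <= y -> s' - s < d ->
  L s (u s) (slope u s s') <= t + e.
Proof.
move=> e0; have [M0 M00 HM0] := Lcoer (T + 1).
have [M M_0 HM] := energy_lip T.
have e20 : 0 < e / 2 by lra.
have [d d0 Hd] := @Lunif (Num.max B M0) _ e20.
have dM : 0 < d / (M + 1) by rewrite divr_gt0//; lra.
(* The second bound makes the [M]-Lipschitz map [u] move by less than [d] over a step, so that
   [(p, u p)] may be replaced by [(s, u s)]. *)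
exists (Num.min d (d / (M + 1))); first by rewrite lt_min d0 dM.
move=> u x y t tT HB Hu s s' xs ss' s'y; rewrite lt_min => /andP[sd sdM].
(* The 1 keeps the slopes in the ball of radius [M0]; the [e/2] leaves room for the change of base
   point. *)
have m0 : 0 < Num.min (e/2) 1 by rewrite lt_min e20 ltr01.
have [d' d'0 Hd'] := Hu _ m0.
apply: (slope_bisect (@Lconvex s (u s) (t + e)) d'0 _ (lexx s) ss' (lexx s')).
move=> p q sp pq qs' pqd' /=.
have xp : x <= p := le_trans xs sp; have qy : q <= y := le_trans qs' s'y.
have h := Hd' p q xp pq qy pqd'.
have m1 : Num.min (e/2) 1 <= e/2 by rewrite ge_min lexx.
have m2 : Num.min (e/2) 1 <= 1 by rewrite ge_min lexx orbT.
have slM : `|slope u p q| <= M0 by apply: HM0; apply: le_trans h _; lra.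
have [pB upB] := HB p (ltac:(apply/andP; split; lra)).
have us : `|u p - u s| < d.
  apply: le_lt_trans (HM _ _ _ _ tT Hu s p xs sp _) _; first lra.
  move: sdM; rewrite ltr_pdivlMr; last lra.
  by move=> ?; nra.
have ps : `|p - s| < d by rewrite ger0_norm; lra.
have := @Hd p s (u p) (u s) (slope u p q) (slope u p q).
rewrite !le_max pB upB slM subrr normr0 !orbT.
move=> /(_ isT isT isT ps us d0); rewrite ltr_norml => /andP[? ?]; lra.
Qed.

(** Only pairs straddling [y] need an argument: their slope is a convex combination of the slopes
    over [[s, y]] and [[y, s']], and the second, controlled at [(y, u y)], is moved to the base
    point [(s, u s)] by uniform continuity. *)
Lemma energy_cat u x y z t : energy_le u x y t -> energy_le u y z t ->
  x <= y -> y <= z -> energy_le u x z t.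
Proof.
move=> H1 H2 xy yz e e0.
have [B1 HB1] := energy_bounded H1; have [B2 HB2] := energy_bounded H2.
have [M0 M00 HM0] := Lcoer (t + 1).
have [M M_0 HM] := energy_lip t.
have e20 : 0 < e / 2 by lra.
have [d d0 Hd] := @Lunif (Num.max B2 M0) _ e20.
have dM : 0 < d / (M + 1) by rewrite divr_gt0//; lra.
have m0 : 0 < Num.min (e/2) 1 by rewrite lt_min e20 ltr01.
have m1 : Num.min (e/2) 1 <= e/2 by rewrite ge_min lexx.
have m2 : Num.min (e/2) 1 <= 1 by rewrite ge_min lexx orbT.
have [d1 d10 Hd1] := H1 _ m0; have [d2 d20 Hd2] := H2 _ m0.
exists (Num.min (Num.min d (d / (M + 1))) (Num.min d1 d2)).
  by rewrite !lt_min d0 dM d10 d20.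
move=> s s' xs ss' s'z; rewrite !lt_min => /andP[/andP[sd sdM] /andP[sd1 sd2]].
have [s'y|ys'] := leP s' y.
  by apply: le_trans (Hd1 s s' xs ss' s'y sd1) _; lra.
have [ys|sy] := leP y s.
  by apply: le_trans (Hd2 s s' ys ss' s'z sd2) _; lra.
apply: (@slope_cvx R V [set P | L s (u s) P <= t + e] u s y s') => //=.
  by apply: le_trans (Hd1 s y xs sy _ _) _; lra.
have h : L y (u y) (slope u y s') <= t + Num.min (e/2) 1 by apply: Hd2 => //; lra.
have slM : `|slope u y s'| <= M0 by apply: HM0; apply: le_trans h _; lra.
have [pB upB] := HB2 y (ltac:(apply/andP; split; lra)).
have us : `|u y - u s| < d.
  apply: le_lt_trans (HM _ _ _ _ (lexx t) H1 s y xs (ltW sy) (lexx y)) _.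
  move: sdM; rewrite ltr_pdivlMr; last lra.
  by move=> ?; nra.
have ps : `|y - s| < d by rewrite ger0_norm; lra.
have := @Hd y s (u y) (u s) (slope u y s') (slope u y s').
rewrite !le_max pB upB slM subrr normr0 !orbT.
move=> /(_ isT isT isT ps us d0); rewrite ltr_norml => /andP[? ?]; lra.
Qed.

(** Adding an affine map shifts every slope by the same vector [d], so uniform continuity of [L]
    bounds the increase. The radius [r] serves all subintervals of [[x, y]]. *)
Lemma energy_affine w x y t e : energy_le w x y t -> 0 < e ->
  exists2 r : R, 0 < r & forall u c d x' y', x <= x' -> y' <= y -> `|d| < r ->
  (forall s, x' <= s <= y' -> u s = w s + (c + s *: d) /\ `|c + s *: d| < r) ->
  energy_le u x' y' (t + e).
Proof.
move=> H e0; have [B HB] := energy_bounded H.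
have [M0 M00 HM0] := Lcoer (t + 1).
have [r r0 Hr] := @Lunif (Num.max B M0) _ e0.
exists r => // u c d x' y' xx' y'y dr Hu e' e'0.
have m0 : 0 < Num.min e' 1 by rewrite lt_min e'0 ltr01.
have m1 : Num.min e' 1 <= e' by rewrite ge_min lexx.
have m2 : Num.min e' 1 <= 1 by rewrite ge_min lexx orbT.
have [k k0 Hk] := H _ m0; exists k => // s s' xs ss' s'y sk.
have h : L s (w s) (slope w s s') <= t + Num.min e' 1 by apply: Hk => //; lra.
have slM : `|slope w s s'| <= M0 by apply: HM0; apply: le_trans h _; lra.
have [sB wB] := HB s (ltac:(apply/andP; split; lra)).
have [us cr] := Hu s (ltac:(apply/andP; split; lra)).
have -> : slope u s s' = slope w s s' + d.
  apply: (@slope_affine _ _ w c) => // z; rewrite !inE => /orP[|] /eqP ->; apply Hu; apply/andP; split; lra.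
rewrite us.
have wr : `|w s - (w s + (c + s *: d))| < r by rewrite opprD addrA subrr add0r normrN.
have sr : `|slope w s s' - (slope w s s' + d)| < r by rewrite opprD addrA subrr add0r normrN.
have := @Hr s s (w s) (w s + (c + s *: d)) (slope w s s') (slope w s s' + d).
rewrite !le_max sB wB slM subrr normr0 !orbT.
move=> /(_ isT isT isT r0 wr sr); rewrite ltr_norml => /andP[? ?]; lra.
Qed.

(** A pair touching an endpoint is the limit of the pairs [(f h, g h)] shrunk towards its middle,
    and [L] and [u] are continuous. Limits along growing intervals and weak derivatives only give
    information strictly inside. *)
Lemma energy_interior u x y t : {within `[x, y], continuous u} ->
  (forall e : R, 0 < e -> exists2 d : R, 0 < d &
  forall s s', x < s -> s < s' -> s' < y -> s' - s < d ->
    L s (u s) (slope u s s') <= t + e) -> energy_le u x y t.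
Proof.
move=> cu H e e0; have [d d0 Hd] := H e e0; exists d => // s s' xs ss' s'y sd.
pose f (h : R) := s + h * (s' - s); pose g (h : R) := s' - h * (s' - s).
have i0 : (h : R) @[h --> 0^'+] --> (0 : R) by exact: cvg_at_right_filter cvg_id.
have fs : f h @[h --> 0^'+] --> s.
  have : f h @[h --> 0^'+] --> s + 0 * (s' - s).
    by apply: cvgD; [exact: cvg_cst|exact: cvgMr_tmp i0].
  by rewrite mul0r addr0.
have gs : g h @[h --> 0^'+] --> s'.
  have : g h @[h --> 0^'+] --> s' - 0 * (s' - s).
    by apply: cvgB; [exact: cvg_cst|exact: cvgMr_tmp i0].
  by rewrite mul0r subr0.
have hcase (k : R -> R) z : x <= z <= y -> k h @[h --> 0^'+] --> z ->
    (\forall h \near 0^'+, x <= k h <= y) -> u (k h) @[h --> 0^'+] --> u z.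
  move=> zxy kz Hk.
  have uz : u @ within `[x, y] (nbhs z) --> u z.
    have := cu z; rewrite /continuous_at /= nbhs_subspace_in//.
  apply: (@cvg_comp _ _ _ k u _ (within `[x, y] (nbhs z))) uz => P /kz.
  by apply: filterS2 Hk => h /[swap] /= + H1; apply; rewrite /= in_itv.
have near1 : \forall h \near (0:R)^'+, 0 < h < 1/2.
  near=> h; apply/andP; split; near: h; first exact: nbhs_right_gt.
  by apply: nbhs_right_lt; lra.
have uf : u (f h) @[h --> 0^'+] --> u s.
  apply: hcase => //; first by apply/andP; split; lra.
  by apply: filterS near1 => h /andP[? ?]; rewrite /f; apply/andP; split; nra.
have ug : u (g h) @[h --> 0^'+] --> u s'.
  apply: hcase => //; first by apply/andP; split; lra.
  by apply: filterS near1 => h /andP[? ?]; rewrite /g; apply/andP; split; nra.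
apply: (L_lim_le fs uf (h := fun h => slope u (f h) (g h))).
  apply: cvgZ; last exact: cvgB.
  by apply: cvgV; [lra|exact: cvgB].
by apply: filterS near1 => h /andP[? ?]; apply: Hd; rewrite /f /g; nra.
Unshelve. all: by end_near.
Qed.

End energy.

(** * Minimisation on a grid *)

Lemma bernoulli (R : realType) (x : R) (m : nat) : 0 <= x -> 1 + m%:R * x <= (1 + x) ^+ m.
Proof.
move=> x0; elim: m => [|m IH]; first by rewrite expr0 mul0r addr0.
rewrite exprS -natr1 mulrDl mul1r.
have : 0 <= m%:R * x by rewrite mulr_ge0.
nra.
Qed.

Section grid.
Context {R : realType} {V : normedModType R} (L : R -> V -> V -> R).
Hypothesis HL : lagrangian L.
Variables (p : nat -> R) (n : nat) (A B : V).
Hypothesis pmono : forall i j, (i <= j)%N -> p i <= p j.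

(** [tau k] is any level dominating the energy of the cell, so the cost is minimised over pairs
    [(u, tau)] and the cell energy is never formed as an infimum. *)
Definition grid_path (u : R -> V) (tau : nat -> R) := [/\ u (p 0) = A, u (p n) = B,
  forall k, (k < n)%N -> 0 <= tau k &
  forall k, (k < n)%N -> energy_le L u (p k) (p k.+1) (tau k)].

Definition grid_cost m (tau : nat -> R) := \sum_(k < n) (1 + tau k) ^+ m.

Definition almost_min m u tau := grid_path u tau /\
  forall w sigma, grid_path w sigma -> grid_cost m tau <= grid_cost m sigma + 1.

Lemma grid_almost_min m u0 tau0 : grid_path u0 tau0 ->
  exists u tau, almost_min m u tau.
Proof.
move=> H0; pose S := [set c | exists w sigma, grid_path w sigma /\ c = grid_cost m sigma].
have hS : has_inf S.
  split; first by exists (grid_cost m tau0), u0, tau0.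
  exists 0 => _ [w [sigma [[_ _ s0 _] ->]]]; apply: sumr_ge0 => k _.
  by rewrite exprn_ge0// addr_ge0// s0.
have [_ [u [tau [Hu ->]]] Hi] := inf_adherent ltr01 hS.
exists u, tau; split => // w sigma Hw.
apply: le_trans (ltW Hi) _; rewrite lerD2r; apply: ge_inf; first exact: hS.2.
by exists w, sigma.
Qed.

Lemma grid_cat u t i j : (forall k, (i <= k < j)%N -> energy_le L u (p k) (p k.+1) t) ->
  (i <= j)%N -> energy_le L u (p i) (p j) t.
Proof.
move=> H ij; rewrite -(subnKC ij).
have : (i + (j - i) <= j)%N by rewrite subnKC.
elim: (j - i)%N => [|d IH] dj.
  rewrite addn0 => e e0; exists 1 => // s s' xs ss' s'y.
  by have := le_lt_trans xs (lt_le_trans ss' s'y); rewrite ltxx.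
rewrite addnS in dj *; apply: (energy_cat HL (y := p (i + d))).
- exact/IH/ltnW.
- by apply: H; rewrite leq_addr.
- by apply: pmono; exact: leq_addr.
- exact: pmono.
Qed.

(** After the splice the terms outside [[p i, p j]] cancel. What remains is at most [n] terms
    [(1 + t) ^+ m] plus the error 1, itself below one such term; each single cell of [u] is bounded
    by this total. *)
Lemma almost_min_level m u tau i j w t : almost_min m u tau ->
  (i <= j <= n)%N -> 0 <= t -> energy_le L w (p i) (p j) t ->
  w (p i) = u (p i) -> w (p j) = u (p j) ->
  forall k, (i <= k < j)%N -> (1 + tau k) ^+ m <= n.+1%:R * (1 + t) ^+ m.
Proof.
move=> [[uA uB tau0 utau] umin] /andP[ij jn] t0 Hw wi wj k0 /andP[ik0 k0j].
(* Splice w into u between the grid points i and j. *)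
pose w' s := if p i <= s <= p j then w s else u s.
pose tau' k := if (i <= k < j)%N then t else tau k.
have w'u s : s <= p i \/ p j <= s -> w' s = u s.
  rewrite /w'; case: ifP => // /andP[h1 h2] [h|h].
  - by have -> : s = p i by apply: le_anti; rewrite h h1.
  - by have -> : s = p j by apply: le_anti; rewrite h h2.
have Hw' : grid_path w' tau'.
  split.
  - by rewrite w'u//; left; exact: pmono.
  - by rewrite w'u//; right; exact: pmono.
  - by move=> k kn; rewrite /tau'; case: ifP => // _; exact: tau0.
  - move=> k kn; rewrite /tau'; case: ifP => [/andP[ik kj]|ikj].
      apply: (@energy_le_eq _ _ _ w) => [s /andP[h1 h2]|].
        rewrite /w' (le_trans _ h1) ?(le_trans h2)//; exact: pmono.
      by apply: energy_le_sub Hw; exact: pmono.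
    apply: (@energy_le_eq _ _ _ u) (utau _ kn) => s /andP[h1 h2].
    rewrite w'u//; move/negbT : ikj; rewrite negb_and -ltnNge -leqNgt => /orP[ki|jk].
      by left; apply: le_trans h2 _; exact: pmono.
    by right; apply: le_trans h1; exact: pmono.
have := umin _ _ Hw'; rewrite /grid_cost.
pose P (k : 'I_n) := (i <= k < j)%N.
rewrite (bigID P) [in leRHS](bigID P)/=.
have -> : \sum_(k < n | ~~ P k) (1 + tau' k) ^+ m = \sum_(k < n | ~~ P k) (1 + tau k) ^+ m.
  by apply: eq_bigr => k /negbTE Pk; rewrite /tau' -/(P k) Pk.
rewrite addrAC lerD2r => h.
have k0n : (k0 < n)%N := leq_trans k0j jn.
apply: (@le_trans _ _ (\sum_(k < n | P k) (1 + tau k) ^+ m)).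
  rewrite (bigD1 (Ordinal k0n)) /=; last by rewrite /P /= ik0.
  rewrite lerDl; apply: sumr_ge0 => k _; rewrite exprn_ge0// addr_ge0//.
  exact: tau0.
apply: le_trans h _; rewrite -natr1 mulrDl mul1r lerD//; last first.
  by rewrite exprn_ege1// lerDl.
have -> : n%:R * (1 + t) ^+ m = \sum_(k < n) (1 + t) ^+ m.
  by rewrite sumr_const card_ord mulr_natl.
rewrite big_mkcond /=; apply: ler_sum => k _; rewrite /tau' /P; case: (i <= k < j)%N => //.
by rewrite exprn_ge0// addr_ge0.
Qed.

(** With exponent [n * n] the factor [n.+1] is absorbed into the power; roots then give
    [tau k <= t + (1 + t) / n] on every cell, and the cells are glued by [grid_cat]. *)
Lemma almost_min_energy u tau i j w t : (0 < n)%N -> almost_min (n * n) u tau ->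
  (i <= j <= n)%N -> 0 <= t -> energy_le L w (p i) (p j) t ->
  w (p i) = u (p i) -> w (p j) = u (p j) ->
  energy_le L u (p i) (p j) (t + (1 + t) / n%:R).
Proof.
move=> n0 Hu /andP[ij jn] t0 Hw wi wj; apply: grid_cat => // k /andP[ik kj].
have kn : (k < n)%N := leq_trans kj jn.
have := almost_min_level Hu (introT andP (conj ij jn)) t0 Hw wi wj (introT andP (conj ik kj)).
move: Hu => [[_ _ tau0 utau] _] h.
apply: energy_leW (utau _ kn).
have n0' : 0 < n%:R :> R by rewrite ltr0n.
have : (1 + tau k) ^+ (n * n) <= ((1 + n%:R^-1) * (1 + t)) ^+ (n * n).
  apply: le_trans h _; rewrite exprMn; apply: ler_wpM2r.
    by rewrite exprn_ge0// addr_ge0.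
  have := @bernoulli R n%:R^-1 (n * n); rewrite invr_ge0 ltW// => /(_ isT).
  by rewrite natrM -mulrA mulfV ?gt_eqF// mulr1 -natr1 addrC.
have b0 : 0 <= (1 + n%:R^-1) * (1 + t) by rewrite mulr_ge0// addr_ge0// invr_ge0 ltW.
rewrite ler_pXn2r ?nnegrE ?addr_ge0 ?tau0 ?muln_gt0 ?n0//.
rewrite mulrDl mul1r (mulrC n%:R^-1) => ?; lra.
Qed.

End grid.

(** * Absolute minimisers of the slope energy *)

(** Along an ultrafilter a cluster point is a limit: for a neighbourhood [A], the preimage of [A] or
    that of its complement belongs to [F], and the latter contradicts clustering. One ultrafilter
    serves all points [s] at once, without subsequences. *)
Lemma ultra_cvg_in_compact (T : Type) (F : set_system T) (V : topologicalType)
    (K : set V) (f : T -> V) : UltraFilter F -> compact K ->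
  (\forall n \near F, K (f n)) -> exists2 a, K a & f n @[n --> F] --> a.
Proof.
move=> UF cK FK; have [a [Ka clu]] := cK _ (fmap_proper_filter f _) FK.
exists a => // A nA; have [//|FA] := in_ultra_setVsetC (f @^-1` A) UF.
have [z [/= nAz Az]] := clu (~` A) A FA nA.
by case: nAz.
Qed.

Section clamp.
Context {R : realType} (a b : R).
Hypothesis ab : a <= b.

(** The monotone 1-Lipschitz retraction onto [[a, b]], used to extend functions from an interval to
    the line. *)
Definition clamp (x : R) := Num.max a (Num.min x b).

Lemma clamp_itv x : a <= clamp x <= b.
Proof. by rewrite /clamp le_max lexx/= ge_max ab ge_min lexx orbT. Qed.

Lemma clamp_id x : a <= x <= b -> clamp x = x.
Proof. by move=> /andP[h1 h2]; rewrite /clamp (min_idPl h2) (max_idPr h1). Qed.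

Lemma clamp_mono x y : x <= y -> clamp x <= clamp y.
Proof.
rewrite /clamp => xy; apply: le_max2 => //.
by rewrite le_min ge_min xy ge_min lexx orbT.
Qed.

Lemma clampB x y : x <= y -> clamp y - clamp x <= y - x.
Proof.
rewrite /clamp /Num.max /Num.min => xy.
by case: (ltP y b) => ?; case: (ltP x b) => ?; repeat case: ltP => ?; lra.
Qed.

End clamp.

Section limit.
Context {R : realType} {V : normedModType R} (L : R -> V -> V -> R).
Hypothesis HL : lagrangian L.
Hypothesis Vcompact : forall M : R, compact [set P : V | `|P| <= M].

Lemma lipschitz_continuous (u : R -> V) (M : R) :
  (forall s s', s <= s' -> `|u s' - u s| <= M * (s' - s)) -> continuous u.
Proof.
move=> Mu x; apply/cvgrPdist_lt => e e0.
have M0 : 0 <= M by have := Mu 0 1 ler01; rewrite subr0 mulr1; exact: le_trans.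
have d0 : 0 < e / (M + 1) by rewrite divr_gt0//; lra.
near=> y.
have : `|x - y| < e / (M + 1) by near: y; apply: cvgr_dist_lt => //; exact: cvg_id.
rewrite ltr_pdivlMr; last lra.
have [xy|yx] := leP x y.
  rewrite distrC ger0_norm ?subr_ge0// => h.
  by rewrite distrC; apply: le_lt_trans (Mu _ _ xy) _; nra.
rewrite ger0_norm ?subr_ge0 1?ltW// => h.
by apply: le_lt_trans (Mu _ _ (ltW yx)) _; nra.
Unshelve. all: by end_near. Qed.

(** By [energy_unif] the step size does not depend on [n], so for a fixed short pair [s < s'] the
    inequality for [U n] passes to the limit with the three values it involves. Derivatives need not
    converge, and the intervals [[xn n, yn n]] need only swallow each interior point. *)
Lemma energy_lsc (F : set_system nat) {FF : ProperFilter F} (U : nat -> R -> V) u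
    (x y t B : R) (xn yn : nat -> R) :
  (forall n s, x <= s <= y -> `|s| <= B /\ `|U n s| <= B) ->
  {within `[x, y], continuous u} ->
  (forall s, x <= s <= y -> U n s @[n --> F] --> u s) ->
  (\forall n \near F, [/\ x <= xn n, yn n <= y & energy_le L (U n) (xn n) (yn n) t]) ->
  (forall s, x < s < y -> \forall n \near F, xn n <= s <= yn n) ->
  energy_le L u x y t.
Proof.
move=> HB cu Uu FU Fs; apply: (energy_interior HL cu) => e e0.
have [d d0 Hd] := energy_unif HL t B e0; exists d => // s s' xs ss' s'y sd.
have s1 : x <= s <= y by apply/andP; split; lra.
have s2 : x <= s' <= y by apply/andP; split; lra.
apply: (@L_lim_le _ _ _ HL _ F _ (fun=> s) (U ^~ s) (fun n => slope (U n) s s')).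
- exact: cvg_cst.
- exact: Uu.
- by apply: slope_cvg; exact: Uu.
have Fs1 := Fs s (ltac:(apply/andP; split; lra)).
have Fs2 := Fs s' (ltac:(apply/andP; split; lra)).
near=> n.
have [xxn yny Hn] : [/\ x <= xn n, yn n <= y & energy_le L (U n) (xn n) (yn n) t] by near: n.
have /andP[h1 _] : xn n <= s <= yn n by near: n.
have /andP[_ h2] : xn n <= s' <= yn n by near: n.
apply: (Hd _ _ _ _ (lexx t) _ Hn) => // z /andP[z1 z2].
by apply: HB; apply/andP; split; lra.
Unshelve. all: by end_near. Qed.

Lemma limit_lip (F : set_system nat) {FF : ProperFilter F} (U : nat -> R -> V) u M :
  (forall n s s', s <= s' -> `|U n s' - U n s| <= M * (s' - s)) ->
  (forall s, U n s @[n --> F] --> u s) ->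
  (forall s s', s <= s' -> `|u s' - u s| <= M * (s' - s)).
Proof.
move=> UM Uu s s' ss'.
apply: (@closed_cvg _ _ F _ (fun n => `|U n s' - U n s|) [set z | z <= M * (s' - s)]).
- exact: closed_le.
- by apply: nearW => n; exact: UM.
- by apply: cvg_norm; apply: cvgB.
Qed.

(** The correction is the affine map interpolating the gaps [dx] and [dy] at the two ends; its slope
    is small because the length of [[x', y']] is bounded below. *)
Lemma energy_connect w x y t e : energy_le L w x y t -> x < y -> 0 < e ->
  exists2 rho : R, 0 < rho & forall x' y' a c, x <= x' -> y' <= y ->
    (y - x) / 2 <= y' - x' -> `|a - w x'| < rho -> `|c - w y'| < rho ->
  exists w', [/\ energy_le L w' x' y' (t + e), w' x' = a & w' y' = c].
Proof.
move=> Hw xy e0; have [r r0 Hr] := energy_affine HL Hw e0.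
(* The gaps differ by less than [2 * rho]. The first term keeps the values of the correction below
   [3 * rho < r], the second keeps its slope below [r] on an interval of length at least
   [(y - x) / 2]. *)
have rho0 : 0 < Num.min (r / 4) (r * (y - x) / 8).
  by rewrite lt_min !divr_gt0// mulr_gt0// subr_gt0.
have rho1 : Num.min (r / 4) (r * (y - x) / 8) <= r / 4 by rewrite ge_min lexx.
have rho2 : Num.min (r / 4) (r * (y - x) / 8) <= r * (y - x) / 8.
  by rewrite ge_min lexx orbT.
exists (Num.min (r / 4) (r * (y - x) / 8)) => //.
move: (Num.min _ _) rho0 rho1 rho2 => rho rho0 rho1 rho2.
move=> x' y' a c x1 y2 xy'; set dx := a - w x'; set dy := c - w y' => ux uy.
have xy'0 : 0 < y' - x' by lra.
pose d := (y' - x')^-1 *: (dy - dx).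
have dxy : `|dy - dx| < 2 * rho by apply: le_lt_trans (ler_normB _ _) _; lra.
have dr : `|d| < r.
  by rewrite normrZ ger0_norm ?invr_ge0 ?ltW// ltr_pdivrMl//; nra.
have ws s : (dx - x' *: d) + s *: d = dx + (s - x') *: d.
  by rewrite scalerBl -!addrA (addrC (s *: d)).
exists (fun s => w s + ((dx - x' *: d) + s *: d)); split.
- apply: Hr x1 y2 dr _ => s /andP[s1 s2]; split => //; rewrite ws.
  apply: le_lt_trans (ler_normD _ _) _.
  suff : `|(s - x') *: d| <= `|dy - dx| by lra.
  rewrite /d scalerA normrZ ler_piMl// ger0_norm; last by apply: divr_ge0; lra.
  by rewrite ler_pdivrMr; lra.
- by rewrite ws subrr scale0r addr0 /dx addrC subrK.
- by rewrite ws /d scalerA mulfV ?gt_eqF// scale1r (addrC dx) subrK /dy addrC subrK.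
Qed.

Section minimiser.
Variables (alpha beta : R) (b : R -> V) (T0 : R).
Hypothesis ab : alpha < beta.
Hypothesis T0_ge0 : 0 <= T0.
Hypothesis b_energy : energy_le L b alpha beta T0.

Definition mesh n : R := (beta - alpha) / n.+1%:R.
Definition gridpt n k : R := alpha + k%:R * mesh n.

Lemma mesh_gt0 n : 0 < mesh n.
Proof. by rewrite divr_gt0// subr_gt0. Qed.

Lemma gridpt_mono n i j : (i <= j)%N -> gridpt n i <= gridpt n j.
Proof. by move=> ij; rewrite lerD2l ler_wpM2r ?ler_nat// ltW// mesh_gt0. Qed.

Lemma gridpt0 n : gridpt n 0 = alpha.
Proof. by rewrite /gridpt mul0r addr0. Qed.

Lemma gridpt_last n : gridpt n n.+1 = beta.
Proof. by rewrite /gridpt /mesh mulrC divfK ?pnatr_eq0// addrC subrK. Qed.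

Lemma mesh_cvg0 : mesh n @[n --> \oo] --> (0 : R).
Proof.
rewrite -(mulr0 (beta - alpha)); apply: cvgMl_tmp.
exact: cvg_harmonic.
Qed.

Lemma gridpt_near n x y : alpha <= x -> x < y -> y <= beta -> mesh n <= (y - x) / 4 ->
  exists ij : nat * nat, [/\ (ij.1 <= ij.2 <= n.+1)%N,
    x <= gridpt n ij.1 <= x + mesh n & y - mesh n <= gridpt n ij.2 <= y].
Proof.
move=> ax xy yb hm; have h0 := mesh_gt0 n.
have key z : alpha <= z -> exists k, gridpt n k <= z < gridpt n k.+1.
  move=> az; exists (Num.truncn ((z - alpha) / mesh n)).
  have : 0 <= (z - alpha) / mesh n by rewrite divr_ge0; lra.
  move=> /truncn_itv; rewrite ler_pdivlMr// ltr_pdivrMr// /gridpt.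
  by move=> /andP[? ?]; apply/andP; split; lra.
have step k : gridpt n k.+1 = gridpt n k + mesh n.
  by rewrite /gridpt -natr1 mulrDl mul1r addrA.
have [i /andP[i1 i2]] := key x ax.
have [j /andP[j1 j2]] := key y (ltac:(lra)).
rewrite !step in i2 j2.
(* [i] and [j] are rounded down, so [i.+1] is the first grid point after [x] and [j] the last one up
   to [y]; the mesh bound keeps them in order. *)
exists (i.+1, j) => /=; rewrite step; split; last 2 first.
- by apply/andP; split; lra.
- by apply/andP; split; lra.
- apply/andP; split; rewrite leqNgt; apply/negP.
    by rewrite ltnS => /(gridpt_mono n); lra.
  by move/(gridpt_mono n); rewrite step gridpt_last; lra.
Qed.

(** What the limit needs to know about an almost minimiser with [n.+1] cells. The level
    [2 * T0 + 1], the same for all [n], comes from comparison with [b]: [T0 + (1 + T0) / n.+1] is at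
    most that. Constancy outside [[alpha, beta]] makes the Lipschitz bound global. *)
Definition grid_minimiser n (u : R -> V) := [/\ u alpha = b alpha, u beta = b beta,
  energy_le L u alpha beta (2 * T0 + 1),
  forall s, u s = u (clamp alpha beta s) &
  forall i j w (t : R), (i <= j <= n.+1)%N -> 0 <= t ->
    energy_le L w (gridpt n i) (gridpt n j) t ->
    w (gridpt n i) = u (gridpt n i) -> w (gridpt n j) = u (gridpt n j) ->
    energy_le L u (gridpt n i) (gridpt n j) (t + (1 + t) / n.+1%:R)].

Lemma grid_minimisers n : exists u, grid_minimiser n u.
Proof.
have bpath : grid_path L (gridpt n) n.+1 (b alpha) (b beta) b (fun=> T0).
  split => //; rewrite ?gridpt0 ?gridpt_last// => k kn.
  apply: energy_le_sub b_energy; first by rewrite -(gridpt0 n) gridpt_mono.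
  by rewrite -(gridpt_last n) gridpt_mono.
have [u [tau umin]] := grid_almost_min (n.+1 * n.+1) bpath.
have cmp := almost_min_energy HL (@gridpt_mono n) (ltn0Sn n) umin.
have [[ua ub _ _] _] := umin; rewrite gridpt0 gridpt_last in ua ub.
have cl x : alpha <= x <= beta -> clamp alpha beta x = x by exact: clamp_id.
have ca : clamp alpha beta alpha = alpha by apply: cl; rewrite lexx ltW.
have cb : clamp alpha beta beta = beta by apply: cl; rewrite lexx ltW.
have cmp' := cmp 0%N n.+1 b T0; rewrite gridpt0 gridpt_last leqnn ua ub in cmp'.
have uE s : alpha <= s <= beta -> u s = u (clamp alpha beta s) by move=> /cl ->.
have pin i : (i <= n.+1)%N -> alpha <= gridpt n i <= beta.
  by move=> i_n; rewrite -(gridpt0 n) -(gridpt_last n) !gridpt_mono.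
exists (u \o clamp alpha beta); split => /=.
- by rewrite ca.
- by rewrite cb.
- apply: (@energy_le_eq _ _ _ u) => //.
  apply: energy_leW (cmp' isT T0_ge0 b_energy erefl erefl).
  rewrite mulr_natl mulr2n -addrA lerD2l addrC.
  by rewrite ler_pdivrMr ?ltr0n// ler_peMr ?ler1n// addr_ge0.
- by move=> s; rewrite (cl (clamp alpha beta s))// clamp_itv// ltW.
- move=> i j w t ij t0 Hw wi wj; have /andP[ilej jn] := ij.
  have pi := pin i (leq_trans ilej jn); have pj := pin j jn.
  apply: (@energy_le_eq _ _ _ u).
    move=> s /andP[s1 s2]; apply: uE; apply/andP; split; lra.
  by apply: cmp Hw _ _ => //; rewrite (wi, wj) cl.
Qed.

Theorem energy_absolute_minimiser : exists u : R -> V, exists M T : R,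
  [/\ u alpha = b alpha, u beta = b beta,
      forall s s', s <= s' -> `|u s' - u s| <= M * (s' - s),
      energy_le L u alpha beta T &
      forall x y w t, alpha <= x -> x < y -> y <= beta -> energy_le L w x y t ->
        w x = u x -> w y = u y -> energy_le L u x y t].
Proof.
have [U HU] := choice grid_minimisers.
have [M M0 HM] := energy_lip HL (2 * T0 + 1).
have UM n s s' : s <= s' -> `|U n s' - U n s| <= M * (s' - s).
  move=> ss'; have [_ _ Un Uc _] := HU n.
  rewrite (Uc s') (Uc s).
  have /andP[h1 h2] := clamp_itv (ltW ab) s.
  have /andP[h3 h4] := clamp_itv (ltW ab) s'.
  apply: le_trans (HM _ _ _ _ (lexx _) Un _ _ h1 (clamp_mono _ _ ss') h4) _.
  by apply: ler_wpM2l => //; exact: clampB.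
have Mab : 0 <= M * (beta - alpha) by rewrite mulr_ge0// subr_ge0 ltW.
pose B : R := `|alpha| + `|beta| + `|b alpha| + M * (beta - alpha).
have UB n s : `|U n s| <= B.
  have [Ua _ _ Uc _] := HU n; rewrite Uc.
  have /andP[h1 h2] := clamp_itv (ltW ab) s.
  have := UM n _ _ h1; rewrite Ua => h3.
  have := ler_normD (U n (clamp alpha beta s) - b alpha) (b alpha); rewrite subrK.
  have : M * (clamp alpha beta s - alpha) <= M * (beta - alpha) by apply: ler_wpM2l => //; lra.
  have := normr_ge0 alpha; have := normr_ge0 beta; rewrite /B; lra.
have sB s : alpha <= s <= beta -> `|s| <= B.
  move=> /andP[h1 h2]; have := ler_norm beta; have := ler_norm (- alpha); rewrite normrN.
  have := normr_ge0 alpha; have := normr_ge0 beta; have := normr_ge0 (b alpha).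
  by move=> *; rewrite ler_norml; apply/andP; split; rewrite /B; lra.
have [F [UF Foo]] := ultraFilterLemma eventually_filter.
have /choice[u Uu] : forall s, exists a : V, U n s @[n --> F] --> a.
  move=> s.
  have [|a _ ?] := @ultra_cvg_in_compact _ F _ _ (U ^~ s) UF (@Vcompact B); last by exists a.
  by apply: nearW => n /=.
have uM s s' : s <= s' -> `|u s' - u s| <= M * (s' - s) by exact: (limit_lip UM Uu).
have cu x y : {within `[x, y], continuous u}.
  by apply: continuous_subspaceT; exact: lipschitz_continuous uM.
have bound x y : alpha <= x -> y <= beta -> forall n s, x <= s <= y -> `|s| <= B /\ `|U n s| <= B.
  by move=> ax yb n s /andP[? ?]; split => //; apply: sB; apply/andP; split; lra.
have mesh0 : mesh n @[n --> F] --> (0 : R) by apply: cvg_trans mesh_cvg0; exact: cvg_app.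
have uc z c : (forall n, U n z = c) -> u z = c.
  move=> Uz; apply: (norm_cvg_unique (Uu z)) => /=.
  by rewrite (_ : U ^~ z = cst c); [exact: cvg_cst|exact/funext].
exists u, M, (2 * T0 + 1); split => //.
- by apply: uc => n; have [] := HU n.
- by apply: uc => n; have [] := HU n.
- apply: (@energy_lsc F _ U u alpha beta _ B (fun=> alpha) (fun=> beta)) => //.
  + exact: bound.
  + by apply: nearW => n; have [] := HU n.
  + by move=> s /andP[h1 h2]; apply: nearW => n; rewrite !ltW.
move=> x y w t ax xy yb Hw wx wy.
have t0 := energy_le_ge0 HL xy Hw.
(* Half of [e] pays for joining the competitor to [U n], the other half for the loss
   [(1 + t + e / 2) / n.+1]. *)
apply: energy_le_lim => e e0.
have e20 : 0 < e / 2 by lra.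
have [rho rho0 Hrho] := energy_connect Hw xy e20.
have [Mw Mw0 HMw] := energy_lip HL t.
have wM := HMw _ _ _ _ (lexx t) Hw.
have /choice[ij Hij] : forall n, exists ij : nat * nat, mesh n <= (y - x) / 4 ->
   [/\ (ij.1 <= ij.2 <= n.+1)%N,
    x <= gridpt n ij.1 <= x + mesh n & y - mesh n <= gridpt n ij.2 <= y].
  move=> n; have [h|h] := leP (mesh n) ((y - x) / 4); last by exists (0, 0)%N.
  by have [ij ?] := gridpt_near ax xy yb h; exists ij.
pose xn n := gridpt n (ij n).1; pose yn n := gridpt n (ij n).2.
have mesh_small d : 0 < d -> \forall n \near F, mesh n < d.
  by move=> d0; exact: (cvgr_lt 0).
have q0 : 0 < (y - x) / 4 by lra.
apply: (@energy_lsc F _ U u x y _ B xn yn) => //; last 1 first.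
- move=> s /andP[xs sy].
  have hs : 0 < Num.min (Num.min (s - x) (y - s)) ((y - x) / 4).
    by rewrite !lt_min !subr_gt0 xs sy.
  apply: filterS (mesh_small _ hs) => n; rewrite !lt_min => /andP[/andP[h1 h2] h3].
  have [_ /andP[h4 h5] /andP[h6 h7]] := Hij n (ltW h3).
  by apply/andP; split; rewrite /xn /yn; lra.
- exact: bound.
(* The second term gives [(M + Mw) * mesh n < rho / 2]. As [U n] is within [rho / 2] of [u] at [x]
   and [y], where [w] equals [u], it is then within [rho] of [w] at the nearby grid points. *)
pose d1 := Num.min ((y - x) / 4) (rho / (2 * (M + Mw + 1))).
have MMw : 0 < 2 * (M + Mw + 1) by lra.
have d10 : 0 < d1 by rewrite lt_min q0 divr_gt0.
have near_u s : \forall n \near F, `|u s - U n s| < rho / 2.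
  by apply: cvgr_dist_lt; [exact: Uu|lra].
have near_inv : \forall n \near F, (1 + t + e / 2) / n.+1%:R < e / 2.
  suff cv0 : (1 + t + e / 2) * harmonic n @[n --> \oo] --> (0 : R).
    exact: Foo (cvgr_lt _ cv0 _ e20).
  have : (1 + t + e / 2) * harmonic n @[n --> \oo] --> (1 + t + e / 2) * 0.
    by apply: cvgMl_tmp; exact: cvg_harmonic.
  by rewrite mulr0.
have near_d1 := mesh_small _ d10.
have near_x := near_u x; have near_y := near_u y.
near=> n.
have : mesh n < d1 by near: n.
rewrite lt_min => /andP[m1 m2].
have [ijn /andP[x1 x2] /andP[y1 y2]] := Hij n (ltW m1).
rewrite -/(xn n) -/(yn n) in x1 x2 y1 y2.
split; [by []|by []|].
have h0 := mesh_gt0 n.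
have ux : `|U n (xn n) - w (xn n)| < rho.
  have e1 : `|U n (xn n) - U n x| <= M * mesh n.
    by apply: le_trans (UM _ _ _ x1) _; apply: ler_wpM2l => //; lra.
  have e2 : `|w (xn n) - u x| <= Mw * mesh n.
    rewrite -wx; apply: le_trans (wM x (xn n) (lexx x) x1 _) _; first lra.
    by apply: ler_wpM2l => //; lra.
  have e3 : `|u x - U n x| < rho / 2 by near: n.
  have e4 : mesh n * (2 * (M + Mw + 1)) < rho by rewrite -ltr_pdivlMr.
  have := ler_distD (U n x) (U n (xn n)) (w (xn n)).
  have := ler_distD (u x) (U n x) (w (xn n)).
  by rewrite (distrC (U n x) (u x)) (distrC (u x) (w _)); lra.
have uy : `|U n (yn n) - w (yn n)| < rho.
  have e1 : `|U n y - U n (yn n)| <= M * mesh n.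
    by apply: le_trans (UM _ _ _ y2) _; apply: ler_wpM2l => //; lra.
  have e2 : `|u y - w (yn n)| <= Mw * mesh n.
    rewrite -wy; apply: le_trans (wM (yn n) y _ y2 (lexx y)) _; first lra.
    by apply: ler_wpM2l => //; lra.
  have e3 : `|u y - U n y| < rho / 2 by near: n.
  have e4 : mesh n * (2 * (M + Mw + 1)) < rho by rewrite -ltr_pdivlMr.
  have := ler_distD (U n y) (U n (yn n)) (w (yn n)).
  have := ler_distD (u y) (U n y) (w (yn n)).
  by rewrite (distrC (U n y) (u y)) (distrC (U n (yn n)) (U n y)); lra.
have xyn : (y - x) / 2 <= yn n - xn n by lra.
have [w' [Hw' w'x w'y]] := Hrho _ _ _ _ x1 y2 xyn ux uy.
have [_ _ _ _ cmp] := HU n.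
have te : 0 <= t + e / 2 by lra.
apply: energy_leW (cmp _ _ _ _ ijn te Hw' w'x w'y).
have : (1 + t + e / 2) / n.+1%:R < e / 2 by near: n.
by rewrite (addrA 1 t); move: (_ / n.+1%:R) => X ?; lra.
Unshelve. all: by end_near.
Qed.

End minimiser.
End limit.

(** * Weak derivatives on the line *)

Section smooth_step.
Context {R : realType}.
Implicit Types (F : R -> R) (x y d K h s : R).

(** Piecewise quadratic functions satisfy such a bound with one constant, so they are differentiated
    without treating the knots separately. *)
Lemma is_derive_quadratic F x d K :
  (forall y, `|F y - F x - d * (y - x)| <= K * (y - x) ^+ 2) -> is_derive x 1 F d.
Proof.
move=> H.
have cv : h^-1 *: ((F \o shift x) (h *: (1 : R)) - F x) @[h --> 0^'] --> d.
  apply/cvgrPdist_le => e e0; near=> h.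
  have h0 : h != 0 by near: h; exact: nbhs_dnbhs_neq.
  have K0 : 0 < `|K| + 1 by rewrite ltr_wpDl.
  have hK : `|h| <= e / (`|K| + 1).
    by near: h; apply: dnbhs0_le; rewrite divr_gt0.
  have := H (h + x); rewrite addrK /= /shift /=.
  have -> : h *: (1 : R) + x = h + x by rewrite [h *: 1]mulr1.
  have -> : d - h^-1 *: (F (h + x) - F x) = - h^-1 * (F (h + x) - F x - d * h).
    by rewrite /GRing.scale /=; field.
  move=> H1; rewrite normrM normrN normfV mulrC ler_pdivrMr ?normr_gt0//.
  apply: le_trans H1 _; rewrite -[h ^+ 2]real_normK ?num_real// expr2 mulrA.
  rewrite ler_wpM2r//; move: hK; rewrite ler_pdivlMr// mulrDr mulr1 mulrC.
  have := ler_norm K; have := normr_ge0 h => *; nra.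
split; first exact: cvgP cv.
exact: (cvg_lim _ cv).
Unshelve. all: by end_near. Qed.

(** The tent on [[0, 2]] of height and mass 1, that is, the linear B-spline. *)
Definition hat x := Num.max x 0 - 2 * Num.max (x - 1) 0 + Num.max (x - 2) 0.

(* The primitive of [hat], written with [x * max x 0] as a C^1 square of the
   positive part. *)
Definition step x := 2^-1 * (x * Num.max x 0 - 2 * ((x - 1) * Num.max (x - 1) 0)
  + (x - 2) * Num.max (x - 2) 0).

Lemma step0 x : x <= 0 -> step x = 0.
Proof. by move=> x0; rewrite /step !max_r; lra. Qed.

Lemma step1 x : 2 <= x -> step x = 1.
Proof. by move=> x2; rewrite /step !max_l; lra. Qed.

Lemma hat0 x : x <= 0 \/ 2 <= x -> hat x = 0.
Proof. by case=> hx; rewrite /hat; [rewrite !max_r|rewrite !max_l]; lra. Qed.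

Lemma hat_ge0 x : 0 <= hat x.
Proof.
by rewrite /hat; case: (leP x 0) => ?; case: (leP (x - 1) 0) => ?;
  case: (leP (x - 2) 0) => ?; lra.
Qed.

Lemma hat_le1 x : hat x <= 1.
Proof.
by rewrite /hat; case: (leP x 0) => ?; case: (leP (x - 1) 0) => ?;
  case: (leP (x - 2) 0) => ?; lra.
Qed.

Lemma step_itv x : 0 <= step x <= 1.
Proof.
by rewrite /step; case: (leP x 0) => ?; case: (leP (x - 1) 0) => ?;
  case: (leP (x - 2) 0) => ?; apply/andP; split; nra.
Qed.

Lemma hat_continuous : continuous hat.
Proof.
have mx (c : R) : continuous (fun x : R => Num.max (x - c) 0).
  move=> x; apply: (@continuous_max _ _ (fun x => x - c) (cst 0)); last exact: cvg_cst.
  by apply: cvgB; [exact: cvg_id|exact: cvg_cst].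
move=> x; rewrite /hat; apply: cvgD; last exact: mx.
apply: cvgB; last by apply: cvgMl_tmp; exact: mx.
by have := mx 0 x; rewrite /continuous_at subr0; under eq_fun do rewrite subr0.
Qed.

(** The function [c * max c 0] has derivative [2 * max c 0] with remainder at most [(c - a) ^+ 2];
    the constant 2 is half the sum of the weights 1, 2, 1 in [step]. *)
Lemma step_quadratic x y : `|step y - step x - hat x * (y - x)| <= 2 * (y - x) ^+ 2.
Proof.
have key (a c : R) : `|c * Num.max c 0 - a * Num.max a 0 - 2 * Num.max a 0 * (c - a)| <= (c - a) ^+ 2.
  by rewrite ler_norml; apply/andP; split; have := sqr_ge0 (c - a);
    case: (leP a 0) => ?; case: (leP c 0) => ?; nra.
have := key x y; have := key (x - 1) (y - 1); have := key (x - 2) (y - 2).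
rewrite (_ : y - 1 - (x - 1) = y - x); last by ring.
rewrite (_ : y - 2 - (x - 2) = y - x); last by ring.
rewrite /step /hat; move: ((y - x) ^+ 2) (y - x) => q d.
move: (Num.max x 0) (Num.max (x - 1) 0) (Num.max (x - 2) 0) => ? ? ?.
move: (_ * Num.max y 0) (_ * Num.max (y - 1) 0) (_ * Num.max (y - 2) 0) => ? ? ?.
rewrite !ler_norml => /andP[? ?] /andP[? ?] /andP[? ?]; apply/andP; split; lra.
Qed.

Section bump.
Variables (s s' h : R).
Hypotheses (h0 : 0 < h) (ss' : s <= s').

(** [kern] is a nonnegative kernel of mass 1 on [[c, c + 2 * h]]. [bump] climbs to 1 just after [s]
    and descends just after [s'], so its derivative is the difference of two kernels. The two ramps
    may overlap. *)
Definition kern c x := hat ((x - c) / h) / h.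
Definition bump x := step ((x - s) / h) - step ((x - s') / h).

Lemma is_derive_step c x : is_derive x 1 (fun y => step ((y - c) / h)) (kern c x).
Proof.
apply: (@is_derive_quadratic _ _ _ (2 / h ^+ 2)) => y.
have := step_quadratic ((x - c) / h) ((y - c) / h).
have -> : (y - c) / h - (x - c) / h = (y - x) / h by ring.
have -> : 2 * ((y - x) / h) ^+ 2 = 2 / h ^+ 2 * (y - x) ^+ 2 by rewrite expr_div_n; ring.
by rewrite /kern mulrA (mulrAC _ (y - x)).
Qed.

Lemma step_continuous c : continuous (fun y => step ((y - c) / h)).
Proof.
move=> x; apply: differentiable_continuous; apply/derivable1_diffP.
by have := is_derive_step c x => ?; exact: ex_derive.
Qed.

Lemma kern_continuous c : continuous (kern c).
Proof.
move=> x; rewrite /kern; apply: cvgMr_tmp.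
apply: (@continuous_comp _ _ _ (fun x => (x - c) / h) hat); last exact: hat_continuous.
by apply: cvgMr_tmp; apply: cvgB; [exact: cvg_id|exact: cvg_cst].
Qed.

Lemma kern_ge0 c x : 0 <= kern c x.
Proof. by rewrite divr_ge0 ?hat_ge0// ltW. Qed.

Lemma kern_le c x : kern c x <= h^-1.
Proof. by rewrite /kern ler_piMl ?hat_le1// invr_ge0 ltW. Qed.

Lemma kern0 c x : ~ (c <= x <= c + 2 * h) -> kern c x = 0.
Proof.
move=> H; rewrite /kern hat0 ?mul0r//.
have [cx|xc] := leP x c; first by left; rewrite pmulr_lle0 ?invr_gt0// subr_le0.
right; rewrite ler_pdivlMr//; apply: contrapT => H2; apply: H; apply/andP; split; first exact: ltW.
by move/negP : H2; rewrite -ltNge; lra.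
Qed.

Lemma bump_derive x : is_derive x 1 bump (kern s x - kern s' x).
Proof. by apply: is_deriveB; exact: is_derive_step. Qed.

Lemma bump_derive1 x : derive1 bump x = kern s x - kern s' x.
Proof. by rewrite derive1E; have := bump_derive x => ?; rewrite derive_val. Qed.

Lemma bump_itv x : 0 <= bump x <= 1.
Proof.
rewrite /bump; have /andP[h1 h2] := step_itv ((x - s) / h).
have /andP[h3 h4] := step_itv ((x - s') / h).
have [xs|sx] := leP ((x - s') / h) 0.
  by rewrite (step0 xs) subr0 h1 h2.
have [xs2|xs2] := leP 2 ((x - s) / h).
  by rewrite (step1 xs2); apply/andP; split; lra.
have m : step ((x - s') / h) <= step ((x - s) / h).
  have : (x - s') / h <= (x - s) / h by rewrite ler_pM2r ?invr_gt0// lerD2l lerN2.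
  move: sx xs2; move: (_ / h) (_ / h) => a b; rewrite /step => *.
  rewrite (max_l (_ : 0 <= a)) ?(max_l (_ : 0 <= b)) ?(max_r (_ : a - 2 <= 0))
    ?(max_r (_ : b - 2 <= 0)); try lra.
  by case: (leP (a - 1) 0) => ?; case: (leP (b - 1) 0) => ?; nra.
by apply/andP; split; lra.
Qed.

Lemma bump1 x : s + 2 * h <= x <= s' -> bump x = 1.
Proof.
move=> /andP[x1 x2]; rewrite /bump step1 ?step0 ?subr0//.
  by rewrite pmulr_lle0 ?invr_gt0// subr_le0.
by rewrite ler_pdivlMr//; lra.
Qed.

Lemma bump0 x : ~ (s <= x <= s' + 2 * h) -> bump x = 0.
Proof.
move=> H; rewrite /bump; have [xs|sx] := leP x s.
  by rewrite !step0 ?subr0// pmulr_lle0 ?invr_gt0// subr_le0// (le_trans xs).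
have x2 : s' + 2 * h <= x.
  apply: contrapT => /negP; rewrite -ltNge => H2; apply: H; apply/andP; split; exact: ltW.
rewrite !step1 ?subrr//; rewrite ler_pdivlMr//; have := ss'; lra.
Qed.

Lemma bump_test U : `[s, s' + 2 * h] `<=` U -> test_function U bump.
Proof.
move=> KU.
have sub : closure [set x | bump x != 0] `<=` `[s, s' + 2 * h].
  rewrite [X in _ `<=` X](closure_id _).1; last exact: itv_closed.
  apply: closureS => x /= /eqP bx; rewrite in_itv /=; apply: contrapT => /bump0.
  exact: bx.
split.
- by move=> x; have := bump_derive x => ?; exact: ex_derive.
- have -> : derive1 bump = (fun x => kern s x - kern s' x) by apply/funext => x; exact: bump_derive1.
  by move=> x; apply: cvgB; exact: kern_continuous.
- by apply: subclosed_compact sub; [exact: closed_closure|exact: segment_compact].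
- exact: subset_trans KU.
Qed.

Lemma kern_integral c : \int[@lebesgue_measure R]_(x in `[c, c + 2 * h]) kern c x = 1.
Proof.
rewrite /Rintegral (@continuous_FTC2 _ _ (fun y => step ((y - c) / h))).
- rewrite step1; last by rewrite ler_pdivlMr//; lra.
  by rewrite step0 ?subrr ?mul0r// sube0.
- by rewrite ltrDl mulr_gt0.
- by apply: continuous_subspaceT; exact: kern_continuous.
- split.
  + by move=> x _; have := is_derive_step c x => ?; exact: ex_derive.
  + by apply: cvg_at_right_filter; exact: step_continuous.
  + by apply: cvg_at_left_filter; exact: step_continuous.
- by move=> x _; rewrite derive1E; have := is_derive_step c x => ?; rewrite derive_val.
Qed.

End bump.
End smooth_step.

(** * From weak derivatives to the fundamental theorem of calculus *)

Section weak1.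
Context {R : realType}.
Notation mu := (@lebesgue_measure R).
Implicit Types (f g v phi : R -> R) (U K : set R).

Lemma ae_imply (P Q : R -> Prop) : (forall x, P x -> Q x) ->
  {ae mu, forall x, P x} -> {ae mu, forall x, Q x}.
Proof. exact: (@filterS _ _ (ae_filter_ringOfSetsType mu)). Qed.

Lemma ae_imply2 (P Q S : R -> Prop) : (forall x, P x -> Q x -> S x) ->
  {ae mu, forall x, P x} -> {ae mu, forall x, Q x} -> {ae mu, forall x, S x}.
Proof. exact: (@filterS2 _ _ (ae_filter_ringOfSetsType mu)). Qed.

(** The scalar case: [weak_derivative] unfolds to this statement for each coordinate. *)
Definition weak_derivative1 U f g := [/\ locally_integrable U f, locally_integrable U g &
  forall phi, test_function U phi ->
    \int[mu]_(x in U) (f x * derive1 phi x) = - \int[mu]_(x in U) (g x * phi x)].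

Lemma integrable_scale K f (k : R) : measurable K -> mu.-integrable K (EFin \o f) ->
  mu.-integrable K (EFin \o (fun x => k * f x)).
Proof.
move=> mK fi; have := integrableZl (mu := mu) (D := K) mK k fi.
by congr (_.-integrable _ _); apply/funext => x /=; rewrite EFinM.
Qed.

Lemma integrable_add K f g : measurable K -> mu.-integrable K (EFin \o f) ->
  mu.-integrable K (EFin \o g) -> mu.-integrable K (EFin \o (fun x => f x + g x)).
Proof.
move=> mK fi gi; have := integrableD (mu := mu) (D := K) mK fi gi.
by congr (_.-integrable _ _); apply/funext => x /=; rewrite EFinD.
Qed.

Lemma integrable_sub K f g : measurable K -> mu.-integrable K (EFin \o f) ->
  mu.-integrable K (EFin \o g) -> mu.-integrable K (EFin \o (fun x => f x - g x)).
Proof.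
move=> mK fi gi; have := integrableB (mu := mu) (D := K) mK fi gi.
by congr (_.-integrable _ _); apply/funext => x /=; rewrite EFinB.
Qed.

Lemma Rintegral_support U K f : K `<=` U -> (forall x, ~ K x -> f x = 0) ->
  \int[mu]_(x in U) f x = \int[mu]_(x in K) f x.
Proof.
move=> KU f0; rewrite Rintegral_mkcond [RHS]Rintegral_mkcond.
apply: eq_Rintegral => x _; rewrite !patchE.
case: ifPn => xU; case: ifPn => xK //.
  by apply: f0 => Kx; move: xK; rewrite notin_setE; apply.
by move: xU; rewrite notin_setE; case; apply: KU; exact: set_mem.
Qed.

Lemma locally_integrable_compact U K g : locally_integrable U g -> K `<=` U -> compact K ->
  mu.-integrable K (EFin \o g).
Proof.
move=> [mg oU ig] KU cK; apply/integrableP; split; last exact: ig.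
by apply/measurable_EFinP; apply: measurable_funS KU mg; exact: open_measurable.
Qed.

Lemma continuous_measurable_on K phi : measurable K -> continuous phi -> measurable_fun K phi.
Proof. by move=> mK cphi; apply: measurable_funTS; exact: continuous_measurable_fun. Qed.

Lemma integrable_bounded_mul K g phi (C : R) : measurable K -> mu.-integrable K (EFin \o g) ->
  measurable_fun K phi -> (forall x, K x -> `|phi x| <= C) ->
  mu.-integrable K (EFin \o (fun x => g x * phi x)).
Proof.
move=> mK ig mphi bphi.
have -> : EFin \o (fun x => g x * phi x) = ((EFin \o g) \* (EFin \o phi))%E.
  by apply/funext => x /=; rewrite EFinM.
apply: integrableMl => //.
exists C; split; first exact: num_real.
by move=> y Cy x /bphi H; apply: le_trans H _; exact: ltW.
Qed.

Lemma kern_average v c h e : 0 < h ->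
  {within `[c, c + 2 * h], continuous v} ->
  (forall x, c <= x <= c + 2 * h -> `|v x - v c| <= e) ->
  `|\int[mu]_(x in `[c, c + 2 * h]) (v x * kern h c x) - v c| <= e.
Proof.
move=> h0 cv ve; pose K := `[c, c + 2 * h]%classic.
have cK : compact K by exact: segment_compact.
have mK : measurable K by exact: compact_measurable.
have iv : mu.-integrable K (EFin \o v) by exact: continuous_compact_integrable.
have ik : mu.-integrable K (EFin \o kern h c).
  apply: continuous_compact_integrable => //.
  by apply: continuous_subspaceT; exact: kern_continuous.
have mk : measurable_fun K (kern h c) by apply: continuous_measurable_on => //; exact: kern_continuous.
have bk x : K x -> `|kern h c x| <= h^-1.
  by move=> _; rewrite ger0_norm ?kern_le// kern_ge0.
have ivk := integrable_bounded_mul mK iv mk bk.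
have ick : mu.-integrable K (EFin \o (fun x => v c * kern h c x)).
  exact: integrable_scale.
have -> : v c = \int[mu]_(x in K) (v c * kern h c x).
  by rewrite RintegralZl// kern_integral// mulr1.
rewrite -RintegralB//.
have -> : e = \int[mu]_(x in K) (e * kern h c x) by rewrite RintegralZl// kern_integral// mulr1.
apply: le_trans (le_normr_Rintegral _ _) _ => //.
  exact: integrable_sub.
apply: le_Rintegral => //.
- apply: integrable_norm; exact: integrable_sub.
- exact: integrable_scale.
- move=> x Kx; rewrite -mulrBl normrM (ger0_norm (kern_ge0 h0 _ _)).
  by apply: ler_wpM2r; [exact: kern_ge0|apply: ve; move: Kx; rewrite /K /= in_itv].
Qed.

(** [bump] differs from the indicator of [[s, s']] only on the two ramps, and there by at most 1. *)
Lemma bump_average g s s' h e : 0 < h -> s <= s' ->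
  mu.-integrable `[s, s' + 2 * h] (EFin \o g) ->
  \int[mu]_(x in `[s, s + 2 * h]) `|g x| <= e ->
  \int[mu]_(x in `[s', s' + 2 * h]) `|g x| <= e ->
  `|\int[mu]_(x in `[s, s' + 2 * h]) (g x * bump s s' h x) - \int[mu]_(x in `[s, s']) g x| <= e + e.
Proof.
move=> h0 ss' ig e1 e2; set K := `[s, s' + 2 * h]%classic in ig *.
have cK : compact K by exact: segment_compact.
have mK : measurable K by exact: compact_measurable.
have sub1 : `[s, s + 2 * h] `<=` K.
  by move=> x; rewrite /K /= !in_itv /= => /andP[? ?]; apply/andP; split; lra.
have sub2 : `[s', s' + 2 * h] `<=` K.
  by move=> x; rewrite /K /= !in_itv /= => /andP[? ?]; apply/andP; split; lra.
have sub3 : `[s, s'] `<=` K.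
  by move=> x; rewrite /K /= !in_itv /= => /andP[? ?]; apply/andP; split; lra.
have patch_int A : measurable A -> A `<=` K -> mu.-integrable K (EFin \o (g \_ A)).
  move=> mA AK; rewrite -restrict_EFin.
  by apply/integrable_restrict => //; rewrite setIidr//; exact: integrableS ig.
have npatch_int A : measurable A -> A `<=` K -> mu.-integrable K (EFin \o ((fun x => `|g x|) \_ A)).
  move=> mA AK; rewrite -restrict_EFin.
  apply/integrable_restrict => //; rewrite setIidr//.
  by apply: integrable_norm; exact: integrableS ig.
have cb : continuous (bump s s' h).
  move=> x; apply: differentiable_continuous; apply/derivable1_diffP.
  by have := bump_derive s s' h x => ?; exact: ex_derive.
have igb : mu.-integrable K (EFin \o (fun x => g x * bump s s' h x)).
  apply: (integrable_bounded_mul (C := 1)) => //; first exact: continuous_measurable_on.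
  by move=> x _; have /andP[? ?] := bump_itv h0 ss' x; rewrite ger0_norm.
have E A F : A `<=` K -> \int[mu]_(x in A) F x = \int[mu]_(x in K) (F \_ A) x.
  by move=> AK; rewrite -Rintegral_mkcondr setIidr.
rewrite (E _ g sub3) -RintegralB//; last by apply: patch_int.
apply: le_trans (lerD e1 e2).
rewrite (E _ _ sub1) (E _ _ sub2) -RintegralD//; [|exact: npatch_int|exact: npatch_int].
have iB := integrable_sub mK igb (patch_int _ (measurable_itv _) sub3).
apply: le_trans (le_normr_Rintegral _ _) _ => //.
apply: le_Rintegral => //.
- exact: integrable_norm.
- exact: (integrable_add mK (npatch_int _ (measurable_itv _) sub1) (npatch_int _ (measurable_itv _) sub2)).
move=> x Kx; rewrite !patchE.
have memE (a b : R) : (x \in `[a, b]%classic) = (a <= x <= b).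
  by apply/idP/idP; rewrite inE /= in_itv.
rewrite !memE; move: Kx; rewrite /K /= in_itv /= => /andP[x1 x2].
rewrite x1 x2 !andbT /=.
have /andP[b0 b1] := bump_itv h0 ss' x.
have g0 := normr_ge0 (g x).
have n1 : `|g x * bump s s' h x - g x| <= `|g x|.
  rewrite -{2}(mulr1 (g x)) -mulrBr normrM ler_piMr// ler0_norm; lra.
have n2 : `|g x * bump s s' h x| <= `|g x| by rewrite normrM ler_piMr// ger0_norm.
have [xs'|s'x] := leP x s'; have [x3|x3] := leP x (s + 2 * h); have [x4|x4] := leP s' x;
  rewrite ?subr0 ?addr0 ?add0r//; try lra.
- by rewrite bump1 ?mulr1 ?subrr ?normr0// (ltW x3) (ltW x4).
Qed.

(** Testing with [bump] gives an average of [v] after [s] minus one after [s'] on the left, and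
    minus the integral of [g] over nearly [[s, s']] on the right. Continuity of [v] and of the
    integral of the modulus of [g] then control the limit as [h] tends to 0. *)
Lemma weak_derivative1_ftc U f g v a c s s' : weak_derivative1 U f g ->
  `]a, c[ `<=` U -> {ae mu, forall x, U x -> v x = f x} ->
  {in `]a, c[, continuous v} -> a < s -> s <= s' -> s' < c ->
  v s' - v s = \int[mu]_(x in `[s, s']) g x.
Proof.
move=> [lf lg wd] acU vf cv as_ ss' s'c.
apply/eqP; rewrite -subr_eq0 -normr_le0; apply/ler_addgt0Pr => e0 e0_gt0; rewrite add0r.
(* One [e] for each kernel average and two for [bump_average]. *)
have [e e_gt0 ->] : exists2 e : R, 0 < e & e0 = 4 * e by exists (e0 / 4); lra.
have gcont z : a < z -> z < c -> exists2 r : R, 0 < r & forall x, `|z - x| < r -> `|v x - v z| <= e.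
  move=> az zc; have /cvgrPdist_le /(_ _ e_gt0) := cv z (ltac:(rewrite in_itv /= az zc //)).
  move=> /nbhs_ballP[r /= r0 Hr]; exists r => // x xr.
  by rewrite distrC; apply: Hr; rewrite /ball /=.
have gint z : a < z -> z < c -> exists2 r : R, 0 < r & forall x, `|z - x| < r ->
    \int[mu]_(y in `[z, x]) `|g y| <= e.
  move=> az zc.
  have zc' : z < (z + c) / 2 by lra.
  have izg : mu.-integrable `[z, (z + c) / 2] (EFin \o (fun y => `|g y|)).
    apply: integrable_norm => //; apply: (locally_integrable_compact lg) => //; last exact: segment_compact.
    by apply: subset_trans acU => y; rewrite /= !in_itv /= => /andP[? ?]; apply/andP; split; lra.
  have := parameterized_integral_cvg_left zc' izg.
  move=> /cvgrPdist_le /(_ _ e_gt0) /nbhs_ballP[r /= r0 Hr]; exists r => // x xr.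
  have := Hr x xr; rewrite sub0r normrN; apply: le_trans; exact: ler_norm.
have sc : s < c by lra.
have as' : a < s' by lra.
have [r1 r10 H1] := gcont s as_ sc; have [r2 r20 H2] := gcont s' as' s'c.
have [r3 r30 H3] := gint s as_ sc; have [r4 r40 H4] := gint s' as' s'c.
have [h h0 [h1 h2 h3 h4 h5]] : exists2 h : R, 0 < h &
   [/\ 2 * h < r1, 2 * h < r2, 2 * h < r3, 2 * h < r4 & 2 * h < c - s'].
  have : 0 < Num.min (Num.min (Num.min r1 r2) (Num.min r3 r4)) (c - s').
    by rewrite !lt_min r10 r20 r30 r40 subr_gt0.
  set m := Num.min _ _ => m0; exists (m / 4); first lra.
  have : 2 * (m / 4) < m by lra.
  by rewrite {2}/m !lt_min => /andP[/andP[/andP[? ?] /andP[? ?]] ?].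
pose K := `[s, s' + 2 * h]%classic.
have KU : K `<=` U.
  by apply: subset_trans acU => y; rewrite /K /= !in_itv /= => /andP[? ?]; apply/andP; split; lra.
have sub1 : `[s, s + 2 * h] `<=` K.
  by move=> x; rewrite /K /= !in_itv /= => /andP[? ?]; apply/andP; split; lra.
have sub2 : `[s', s' + 2 * h] `<=` K.
  by move=> x; rewrite /K /= !in_itv /= => /andP[? ?]; apply/andP; split; lra.
have cK : compact K by exact: segment_compact.
have mK : measurable K by exact: compact_measurable.
have ig : mu.-integrable K (EFin \o g) by exact: locally_integrable_compact lg KU cK.
have A1 := bump_average h0 ss' ig (H3 (s + 2 * h) _) (H4 (s' + 2 * h) _).
have cvK (x y : R) : a < x -> y < c -> {within `[x, y], continuous v}.
  move=> ax yc; apply: continuous_in_subspaceT => z; rewrite inE /= in_itv /= => /andP[? ?].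
  by apply: cv; rewrite in_itv /=; apply/andP; split; lra.
have ivK : mu.-integrable K (EFin \o v).
  by apply: continuous_compact_integrable => //; apply: cvK; lra.
have B1 := @kern_average v s h e h0 (cvK _ _ _ _).
have B2 := @kern_average v s' h e h0 (cvK _ _ _ _).
have ik z : mu.-integrable K (EFin \o (fun x => v x * kern h z x)).
  apply: (integrable_bounded_mul (C := h^-1)) => //.
    by apply: continuous_measurable_on => //; exact: kern_continuous.
  by move=> x _; rewrite ger0_norm ?kern_le// kern_ge0.
have := wd _ (bump_test h0 ss' KU).
rewrite (@Rintegral_support U K); last 2 first => //.
  move=> x Kx; rewrite bump_derive1// !kern0 ?subrr ?mulr0// => xx; apply: Kx.
    by apply: sub2; rewrite /= in_itv.
  by apply: sub1; rewrite /= in_itv.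
rewrite (@Rintegral_support U K _ KU); last first.
  by move=> x Kx; rewrite bump0 ?mulr0// => xx; apply: Kx; rewrite /K /= in_itv.
have -> : \int[mu]_(x in K) (f x * derive1 (bump s s' h) x) =
  \int[mu]_(x in K) (v x * kern h s x) - \int[mu]_(x in K) (v x * kern h s' x).
  rewrite -RintegralB//.
  rewrite /Rintegral; congr fine; apply: ae_eq_integral => //.
  - apply/measurable_EFinP; apply: measurable_funM.
      have [mf oU _] := lf.
      by apply: measurable_funS KU mf; exact: open_measurable.
    apply: continuous_measurable_on => //.
    by have [_ ? _ _] := bump_test h0 ss' KU.
  - by have /integrableP[] := integrable_sub mK (ik s) (ik s').
  - apply: ae_imply vf => x vf Kx; rewrite bump_derive1//= vf ?mulrBr//; exact: KU.
rewrite (@Rintegral_support K `[s, s + 2 * h])//; last first.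
  by move=> x xx; rewrite kern0 ?mulr0// => xx'; apply: xx; rewrite /= in_itv.
rewrite (@Rintegral_support K `[s', s' + 2 * h])//; last first.
  by move=> x xx; rewrite kern0 ?mulr0// => xx'; apply: xx; rewrite /= in_itv.
move: A1 B1 B2; rewrite -/K.
have nn (z x : R) : z <= x <= z + 2 * h -> `|z - x| <= 2 * h.
  by move=> /andP[? ?]; rewrite ler0_norm; lra.
move=> A1 B1 B2 EQ.
have ns z : `|z - (z + 2 * h)| = 2 * h by rewrite ler0_norm; lra.
have {}A1 := A1 (ltac:(rewrite ns //)) (ltac:(rewrite ns //)).
have {}B1 := B1 (ltac:(lra)) (ltac:(lra)) (fun x xx => H1 x (le_lt_trans (nn _ _ xx) h1)).
have {}B2 := B2 (ltac:(lra)) (ltac:(lra)) (fun x xx => H2 x (le_lt_trans (nn _ _ xx) h2)).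
move: A1 B1 B2; rewrite !ler_norml => /andP[? ?] /andP[? ?] /andP[? ?]; apply/andP; split; lra.
Qed.

End weak1.

(** * Differentiation almost everywhere and densities of Lipschitz functions *)

Section density.
Context {R : realType}.
Notation mu := (@lebesgue_measure R).
Implicit Types (f g v phi : R -> R) (U K : set R).

Lemma Rintegral_cst_itv (k s s' : R) : s <= s' -> \int[mu]_(x in `[s, s']) k = k * (s' - s).
Proof.
move=> ss'; rewrite Rintegral_cst; last exact: measurable_itv.
congr (_ * _); apply: (etrans (congr1 fine (lebesgue_measure_itv `[s, s']))).
rewrite /= lte_fin.
case: ltP => //= s's; apply/esym/eqP; rewrite subr_eq0; apply/eqP/le_anti.
by rewrite ss' s's.
Qed.

(** Lebesgue differentiation of the integral from minus infinity: once [g] is extended by zero, this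
    integral differs from [v] by the constant [v a] on [[a, c]]. *)
Lemma integral_is_derive_ae g v a c : a < c -> mu.-integrable `[a, c] (EFin \o g) ->
  (forall x, a <= x <= c -> v x - v a = \int[mu]_(y in `[a, x]) g y) ->
  {ae mu, forall z, a < z < c -> is_derive z 1 v (g z)}.
Proof.
move=> ac ig Hv.
pose gt := g \_ `[a, c].
have mac : measurable (`[a, c]%classic : set R) by exact: measurable_itv.
have igt : mu.-integrable setT (EFin \o gt).
  by rewrite -restrict_EFin; apply/(integrable_mkcond _ _).1.
have igy y : mu.-integrable `]-oo, y] (EFin \o gt) by exact: integrableS igt.
have lgt : locally_integrable setT gt by exact: integrable_locally_restrict.
have := FTC1Ny igy lgt; apply: ae_imply => z dz /andP[az zc].
have -> : g z = gt z.
  by rewrite /gt patchE mem_set//= in_itv /= !ltW.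
have [d1 <-] := dz.
set F := fun x : R => \int[mu]_(t in `]-oo, x]) gt t.
have dF : is_derive z 1 F (derive1 F z) by rewrite derive1E; split.
have : is_derive z 1 (F \+ cst (v a)) (derive1 F z + 0) by apply: is_deriveD.
rewrite addr0; apply: near_eq_is_derive; near=> x.
have /andP[ax xc] : a <= x <= c.
  near: x; apply: filterS (near_in_itvoo (_ : z \in `]a, c[)); last by rewrite in_itv /= az.
  by move=> x; rewrite in_itv /= => /andP[? ?]; rewrite !ltW.
rewrite /= /F -(subrK (v a) (v x)) Hv ?ax//; congr (_ + _).
rewrite /gt -Rintegral_mkcondr; congr (Rintegral _ _ _).
apply/seteqP; split => y /=; rewrite !in_itv /=.
  by move=> [? /andP[-> _]].
by move=> /andP[h1 h2]; split => //; rewrite h1 (le_trans h2).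
Unshelve. all: by end_near. Qed.

(** [g] is only locally integrable in the open interval, so the interval is exhausted by countably
    many compact ones. *)
Lemma weak_derivative1_is_derive_ae U f g v a c : a < c -> weak_derivative1 U f g ->
  `]a, c[ `<=` U -> {ae mu, forall x, U x -> v x = f x} ->
  {in `]a, c[, continuous v} -> {ae mu, forall z, a < z < c -> is_derive z 1 v (g z)}.
Proof.
move=> ac wd acU vf cv.
(* [n.+2] instead of [n.+1] keeps the compact intervals nondegenerate from [n = 0] on. *)
pose r n : R := (c - a) / 2 * n.+2%:R^-1.
have rn n : 0 < r n < (c - a) / 2.
  have d0 : 0 < (c - a) / 2 by lra.
  rewrite mulr_gt0 ?invr_gt0 ?ltr0n//= gtr_pMr// invf_lt1 ?ltr0n// ltr1n//.
have H n : {ae mu, forall z, a + r n < z < c - r n -> is_derive z 1 v (g z)}.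
  have /andP[r0 r1] := rn n.
  apply: integral_is_derive_ae; first lra.
    have [_ lg _] := wd; apply: (locally_integrable_compact lg); last exact: segment_compact.
    by apply: subset_trans acU => y; rewrite /= !in_itv /= => /andP[? ?]; apply/andP; split; lra.
  by move=> x /andP[? ?]; apply: (weak_derivative1_ftc wd acU vf cv); lra.
apply: ae_imply (ae_foralln H) => z Hz /andP[az zc].
have : 0 < Num.min (z - a) (c - z) by rewrite lt_min !subr_gt0 az.
set m := Num.min _ _ => m0.
have [n rnm] : exists n, r n < m.
  exists (Num.truncn ((c - a) / 2 / m)).
  have : 0 <= (c - a) / 2 / m by rewrite !divr_ge0//; lra.
  move=> /truncn_itv/andP[_]; set n := Num.truncn _ => h.
  rewrite /r ltr_pdivrMr ?ltr0n// (mulrC m) -ltr_pdivrMr//.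
  by apply: lt_le_trans h _; rewrite ler_nat.
apply: (Hz n); move: rnm; rewrite /m lt_min => /andP[? ?]; apply/andP; split; lra.
Qed.

Lemma lebesgue_stieltjes_ocitv (F : cumulative R R) (x y : R) : x <= y ->
  lebesgue_stieltjes_measure F `]x, y] = (F y - F x)%:E.
Proof.
move=> xy; rewrite /lebesgue_stieltjes_measure /measure_extension.
rewrite measurable_mu_extE/=; last exact: is_ocitv.
by rewrite wlength_itv_bnd.
Qed.

(* The measures of F and of k x - F x add up to k times the Lebesgue measure. *)
Lemma lebesgue_stieltjes_null (F : cumulative R R) (k : R) : 0 < k ->
  (forall x y, x <= y -> F y - F x <= k * (y - x)) ->
  forall A, measurable A -> mu A = 0%E -> lebesgue_stieltjes_measure F A = 0%E.
Proof.
move=> k0 Fk.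
pose H (x : R) := k * x - F x.
have Hnd : {homo H : x y / x <= y}.
  by move=> x y xy; have := Fk x y xy; rewrite /H; lra.
have Hrc : right_continuous H.
  move=> x; apply: cvgB; last exact: cumulative_is_right_continuous.
  by apply: cvgMl_tmp; exact: cvg_at_right_filter cvg_id.
pose Hc : cumulative R R := HB.pack H (isCumulative.Build R _ R H Hnd Hrc).
have ki0 : 0 <= k^-1 by rewrite invr_ge0 ltW.
pose nu := mscale (NngNum ki0) (measure_add (lebesgue_stieltjes_measure F) (lebesgue_stieltjes_measure Hc)).
have nuE B : nu B = ((k^-1)%:E * (lebesgue_stieltjes_measure F B + lebesgue_stieltjes_measure Hc B))%E.
  by rewrite -measure_addE.
have E A : measurable A -> mu A = nu A.
  apply: lebesgue_stieltjes_measure_unique => _ [[x y] _ <-] /=.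
  have [xy|yx] := leP x y; last by rewrite set_itv_ge ?bnd_simp -?leNgt ?ltW// !measure0.
  symmetry; apply: (etrans (nuE _)).
  by rewrite !lebesgue_stieltjes_ocitv//= -EFinD -EFinM /H; congr (_%:E); field; lra.
move=> A mA; rewrite E// nuE => /eqP.
rewrite mule_eq0 => /orP[/eqP[]/eqP|].
  by rewrite invr_eq0 gt_eqF.
rewrite padde_eq0 => [/andP[/eqP //]| |]; exact: measure_ge0.
Qed.

(** Radon-Nikodym applies to measures, so [f] is made increasing by adding slope [M + 1]; the extra
    1 keeps the total increase [d] positive even if [f] decreases with slope [- M]. Clamping gives
    the limits 0 and 1 at infinity, and the upper bound on slopes gives absolute continuity. *)
Lemma lipschitz_density_raw f M a c : a < c ->
  (forall s s', s <= s' -> `|f s' - f s| <= M * (s' - s)) ->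
  exists g, [/\ measurable_fun setT g, mu.-integrable `[a, c] (EFin \o g) &
    forall s s', a <= s -> s <= s' -> s' <= c -> f s' - f s = \int[mu]_(x in `[s, s']) g x].
Proof.
move=> ac fM.
have M0 : 0 <= M by have := fM 0 1 ler01; rewrite subr0 mulr1; exact: le_trans.
(* q is nondecreasing, and F is its normalisation to a distribution function. *)
pose q x := f (clamp a c x) + (M + 1) * clamp a c x.
have qB x y : x <= y -> 0 <= q y - q x <= (2 * M + 1) * (y - x).
  move=> xy; have cxy := clamp_mono a c xy; have clB := clampB a c xy.
  have := fM _ _ cxy; rewrite ler_norml /q => /andP[? ?].
  by apply/andP; split; nra.
have clac x : a <= x <= c -> clamp a c x = x by exact: clamp_id.
pose d := q c - q a.
have d0 : 0 < d.
  rewrite /d /q !clac ?lexx ?ltW//; have := fM a c (ltW ac); rewrite ler_norml => /andP[? ?].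
  nra.
pose F x := (q x - q a) / d.
have FB x y : x <= y -> 0 <= F y - F x <= (2 * M + 1) / d * (y - x).
  move=> /qB/andP[h1 h2].
  have -> : F y - F x = (q y - q x) / d by rewrite /F; ring.
  rewrite divr_ge0 ?(ltW d0)//= mulrAC; apply: ler_wpM2r => //.
  by rewrite invr_ge0 ltW.
have Fnd : {homo F : x y / x <= y} by move=> x y /FB/andP[+ _]; rewrite subr_ge0.
have Fc : continuous F.
  apply: (@lipschitz_continuous _ _ F ((2 * M + 1) / d)) => x y xy.
  by have /andP[h1 h2] := FB _ _ xy; rewrite ger0_norm.
have FN : F x @[x --> -oo] --> (0 : R).
  apply: cvg_near_cst; near=> x.
  have xa : x <= a by near: x; exists a; split; [exact: num_real|move=> y /ltW].
  by rewrite /F /q /clamp (min_l (le_trans xa (ltW ac))) (max_l xa) (min_l (ltW ac)) max_l// subrr mul0r.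
have FP : F x @[x --> +oo] --> (1 : R).
  apply: cvg_near_cst; near=> x.
  have cx : c <= x by near: x; exists c; split; [exact: num_real|move=> y /ltW].
  rewrite /F (_ : q x = q c) ?mulfV ?gt_eqF// /q /clamp.
  by rewrite (min_r cx) (min_r (lexx c)).
pose Fb : cumulativeBounded (0 : R) (1 : R) := HB.pack F
  (isCumulative.Build R _ R F Fnd (right_continuousW Fc))
  (isCumulativeBounded.Build R 0 1 F FN FP).
pose P := lebesgue_stieltjes_measure Fb.
have k0 : 0 < (2 * M + 1) / d by rewrite divr_gt0//; lra.
have Pdom : P `<< mu.
  apply/null_content_dominatesP => A mA muA.
  by apply: (lebesgue_stieltjes_null k0 _ mA muA) => x y /FB/andP[].
have [G [G0 Gfin Gint GP]] := radon_nikodym_sigma_finite Pdom.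
pose h x := fine (G x).
have hG : EFin \o h = G by apply/funext => x /=; rewrite /h fineK.
have ih : mu.-integrable setT (EFin \o h) by rewrite hG.
have ihK (K : set R) : measurable K -> mu.-integrable K (EFin \o h) by move=> mK; exact: integrableS ih.
have hF s s' : s <= s' -> \int[mu]_(x in `[s, s']) h x = F s' - F s.
  move=> ss'; rewrite -Rintegral_itv_obnd_cbnd; last exact: ihK.
  rewrite /Rintegral -[X in fine X]/(\int[mu]_(x in `]s, s']) ((EFin \o h) x))%E hG -GP//.
  exact: (congr1 fine (lebesgue_stieltjes_ocitv Fb ss')).
have icst (k : R) (x y : R) : mu.-integrable `[x, y] (EFin \o (fun=> k)).
  apply: continuous_compact_integrable; first exact: segment_compact.
  by apply: continuous_subspaceT => z; exact: cvg_cst.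
have mitv (x y : R) : measurable (`[x, y]%classic : set R) by exact: measurable_itv.
have idh x y : mu.-integrable `[x, y] (EFin \o (fun z => d * h z)).
  by apply: integrable_scale => //; exact: ihK.
(* Undoes the normalisation: on [[a, c]], [f] is [d * F] minus the added slope, up to a constant. *)
exists (fun x => d * h x - (M + 1)); split.
- apply: measurable_funB => //; apply: measurable_funM => //.
  by apply/measurable_EFinP; case/integrableP : ih.
- by apply: integrable_sub.
- move=> s s' as_ ss' s'c.
  rewrite RintegralB; [|exact: mitv|exact: idh|exact: icst].
  rewrite RintegralZl//; last exact: ihK.
  rewrite hF// Rintegral_cst_itv//.
  rewrite /F /q !clac; try (apply/andP; split; lra).
  by field; lra.
Unshelve. all: by end_near. Qed.

Lemma is_derive_lipschitz f (M z l : R) :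
  (forall s s', s <= s' -> `|f s' - f s| <= M * (s' - s)) -> is_derive z 1 f l -> `|l| <= M.
Proof.
move=> fM [df <-].
have H : \forall h \near (0 : R)^', [set y | y <= M] `|h^-1 *: ((f \o shift z) (h *: (1 : R)) - f z)|.
  near=> h.
  have h0 : h != 0 by near: h; exact: nbhs_dnbhs_neq.
  rewrite /= [h *: _]mulr1 /shift normrZ normfV mulrC ler_pdivrMr ?normr_gt0//.
  have [hp|hn] := leP 0 h.
    by have := fM z (h + z); rewrite addrK (ger0_norm hp) lerDr; apply.
  rewrite distrC (ler0_norm (ltW hn)).
  by have := fM (h + z) z; rewrite opprD addrCA subrr addr0 gerDr ltW//; apply.
by apply: (closed_cvg [set y | y <= M] (@closed_le _ M) H); apply: cvg_norm; exact: df.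
Unshelve. all: by end_near. Qed.

(** The raw density equals the derivative of [f] almost everywhere, hence is bounded by [M] there;
    truncating it makes the bound hold everywhere and preserves its integrals. *)
Lemma lipschitz_density f M a c : a < c ->
  (forall s s', s <= s' -> `|f s' - f s| <= M * (s' - s)) ->
  exists g, [/\ measurable_fun setT g, forall x, `|g x| <= M &
    forall s s', a <= s -> s <= s' -> s' <= c -> f s' - f s = \int[mu]_(x in `[s, s']) g x].
Proof.
move=> ac fM.
have M0 : 0 <= M by have := fM 0 1 ler01; rewrite subr0 mulr1; exact: le_trans.
(* Enlarging the interval makes the endpoints [a] and [c] interior, where the derivative statement
   applies. *)
have ac' : a - 1 < c + 1 by lra.
have [g0 [mg0 ig0 fg0]] := lipschitz_density_raw ac' fM.
have dae : {ae mu, forall z, a - 1 < z < c + 1 -> is_derive z 1 f (g0 z)}.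
  by apply: integral_is_derive_ae => // x /andP[? ?]; apply: fg0.
have mg : measurable_fun setT (fun x => Num.max (- M) (Num.min (g0 x) M)).
  by apply: measurable_maxr => //; exact: measurable_minr.
exists (fun x => Num.max (- M) (Num.min (g0 x) M)); split => //.
- by move=> x; rewrite ler_norml le_max lexx/= ge_max ge_min lexx orbT andbT; lra.
- move=> s s' as_ ss' s'c; rewrite fg0; try lra.
  rewrite /Rintegral; congr fine; apply: ae_eq_integral => //.
  + by apply/measurable_EFinP; exact: measurable_funTS.
  + by apply/measurable_EFinP; exact: measurable_funTS.
  apply: ae_imply dae => x dx; rewrite /= in_itv /= => /andP[? ?]; congr (_%:E).
  have /(is_derive_lipschitz fM) : is_derive x 1 f (g0 x) by apply: dx; apply/andP; split; lra.
  by rewrite ler_norml => /andP[? ?]; rewrite min_l// max_r.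
Qed.

End density.

(** * Integration by parts for Lipschitz functions *)

Section parts.
Context {R : realType}.
Notation mu := (@lebesgue_measure R).
Implicit Types (f g h phi : R -> R) (U K : set R).

(** The bound makes the derivative vanish everywhere; composition with [clamp] turns [h] into a
    function on the line with the same bound. *)
Lemma quadratic_constant h (a c C : R) : a <= c ->
  (forall x y, a <= x -> x <= y -> y <= c -> `|h y - h x| <= C * (y - x) ^+ 2) -> h c = h a.
Proof.
move=> ac H.
have C0 : a < c -> 0 <= C.
  move=> ac'; have := H a c (lexx a) ac (lexx c) => h1.
  have h2 : 0 < (c - a) ^+ 2 by rewrite exprn_gt0// subr_gt0.
  by rewrite -(pmulr_lge0 _ h2); apply: le_trans h1.
have [eac|neac] := eqVneq a c; first by rewrite eac.
have {}C0 : 0 <= C by apply: C0; rewrite lt_neqAle neac.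
have ca : clamp a c a = a by rewrite clamp_id// lexx.
have cc : clamp a c c = c by rewrite clamp_id// lexx andbT.
suff : (h \o clamp a c) c = (h \o clamp a c) a by rewrite /= ca cc.
apply: is_derive_0_is_cst => x; apply: (@is_derive_quadratic _ _ _ _ C) => y.
rewrite mul0r subr0 /=.
have main z z' : z <= z' -> `|h (clamp a c z') - h (clamp a c z)| <= C * (z' - z) ^+ 2.
  move=> zz'; have /andP[h1 h2] := clamp_itv ac z; have /andP[h3 h4] := clamp_itv ac z'.
  apply: le_trans (H _ _ h1 (clamp_mono a c zz') h4) _.
  apply: ler_wpM2l => //; by rewrite ler_pXn2r ?nnegrE ?subr_ge0 ?clamp_mono// clampB.
have [xy|yx] := leP x y; first exact: main.
by rewrite distrC -sqrrN opprB; apply: main; exact: ltW.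
Qed.

Lemma Rintegral_le_bound h (s s' C : R) : s <= s' -> mu.-integrable `[s, s'] (EFin \o h) ->
  (forall x, s <= x <= s' -> `|h x| <= C) ->
  `|\int[mu]_(x in `[s, s']) h x| <= C * (s' - s).
Proof.
move=> ss' ih hC; have mK : measurable (`[s, s']%classic : set R) by exact: measurable_itv.
apply: le_trans (le_normr_Rintegral _ _) _ => //.
rewrite -Rintegral_cst_itv//; apply: le_Rintegral => //.
- exact: integrable_norm.
- apply: continuous_compact_integrable; first exact: segment_compact.
  by apply: continuous_subspaceT => z; exact: cvg_cst.
Qed.

Lemma Rintegral_itv_subr h (a x y : R) : a <= x -> x <= y -> mu.-integrable `[a, y] (EFin \o h) ->
  \int[mu]_(z in `[a, y]) h z - \int[mu]_(z in `[a, x]) h z = \int[mu]_(z in `[x, y]) h z.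
Proof.
move=> ax xy ih; rewrite Rintegral_itvB//.
apply: Rintegral_itv_obnd_cbnd; apply: integrableS ih => //.
by move=> z /=; rewrite !in_itv /= => /andP[h1 ->]; rewrite (le_trans ax (ltW h1)).
Qed.

Lemma lipschitz_weak_derivative1 f g (M a c : R) : a < c ->
  (forall s s', s <= s' -> `|f s' - f s| <= M * (s' - s)) ->
  measurable_fun setT g -> (forall x, `|g x| <= M) ->
  (forall s s', a <= s -> s <= s' -> s' <= c -> f s' - f s = \int[mu]_(x in `[s, s']) g x) ->
  weak_derivative1 `]a, c[ f g.
Proof.
move=> ac fM mg gM fg.
have cf : continuous f by exact: (@lipschitz_continuous _ _ f M).
have M0 : 0 <= M by apply: le_trans (gM 0).
have mitv (x y : R) : measurable (`[x, y]%classic : set R) by exact: measurable_itv.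
have cint (h : R -> R) (x y : R) : continuous h -> mu.-integrable `[x, y] (EFin \o h).
  move=> ch; apply: continuous_compact_integrable; first exact: segment_compact.
  exact: continuous_subspaceT.
have one_int K : compact K -> mu.-integrable K (EFin \o (cst (1 : R))).
  move=> cK; apply: continuous_compact_integrable => //.
  by apply: continuous_subspaceT => z; exact: cvg_cst.
have gint K : compact K -> mu.-integrable K (EFin \o g).
  move=> cK; have mK := compact_measurable cK.
  have := @integrable_bounded_mul _ K (cst 1) g M mK (one_int K cK) _ _.
  under [fun x => cst 1 x * g x]eq_fun do rewrite mul1r.
  by apply => //; exact: measurable_funTS.
have loc (h : R -> R) : measurable_fun setT h -> (forall K, compact K -> mu.-integrable K (EFin \o h)) ->
    locally_integrable `]a, c[ h.
  move=> mh ih; split; [exact: measurable_funTS|exact: itv_open|].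
  by move=> K _ /ih/integrableP[].
split.
- apply: loc; first exact: continuous_measurable_fun.
  by move=> K cK; apply: continuous_compact_integrable => //; exact: continuous_subspaceT.
- exact: loc.
move=> phi [dphi cphi' _ sphi].
set phi' := derive1 phi in cphi' *.
have cphi : continuous phi.
  by move=> x; apply: differentiable_continuous; exact/derivable1_diffP.
have phi0 x : ~ `]a, c[%classic x -> phi x = 0.
  move=> xac; apply: contrapT => /eqP phix; apply: xac; apply: sphi.
  exact: subset_closure.
have phia : phi a = 0 by apply: phi0; rewrite /= in_itv /= ltxx.
have phic : phi c = 0 by apply: phi0; rewrite /= in_itv /= ltxx andbF.
have [C C0 phiC] : exists2 C : R, 0 <= C & forall x, a <= x <= c -> `|phi' x| <= C.
  have : compact (phi' @` `[a, c]).
    by apply: continuous_compact; [exact: continuous_subspaceT|exact: segment_compact].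
  move=> /compact_bounded[N [_ HN]]; exists (`|N| + 1); first exact: addr_ge0.
  move=> x xac; apply: (HN (`|N| + 1)); last by exists x => //; rewrite /= in_itv.
  by rewrite (le_lt_trans (ler_norm N))// ltrDl.
have phiftc x y : x <= y -> phi y - phi x = \int[mu]_(z in `[x, y]) phi' z.
  rewrite le_eqVlt => /predU1P[->|xy].
    by rewrite subrr set_itv1 Rintegral_set1.
  have pLR : derivable_oo_LRcontinuous phi x y.
    split; first by move=> z _; exact: dphi.
      by apply: cvg_at_right_filter; exact: cphi.
    by apply: cvg_at_left_filter; exact: cphi.
  have F2 := continuous_FTC2 xy (continuous_subspaceT (A := `[x, y]) cphi') pLR (fun z _ => erefl).
  by rewrite /Rintegral F2.
have phiL x y : a <= x -> x <= y -> y <= c -> `|phi y - phi x| <= C * (y - x).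
  move=> ax xy yc; rewrite phiftc//; apply: Rintegral_le_bound => //; first exact: cint.
  by move=> z /andP[? ?]; apply: phiC; apply/andP; split; lra.
have iff' x y : mu.-integrable `[x, y] (EFin \o (fun z => f z * phi' z)).
  by apply: cint => z; apply: cvgM; [exact: cf|exact: cphi'].
have ig x y : mu.-integrable `[x, y] (EFin \o g) by apply: gint; exact: segment_compact.
have mphi x y : measurable_fun (`[x, y]%classic : set R) phi.
  by apply: measurable_funTS; exact: continuous_measurable_fun.
have igf x y : mu.-integrable `[x, y] (EFin \o (fun z => g z * phi z)).
  have : compact (phi @` `[x, y]).
    by apply: continuous_compact; [exact: continuous_subspaceT|exact: segment_compact].
  move=> /compact_bounded[N [_ HN]].
  apply: (integrable_bounded_mul (C := `|N| + 1)) => // z xz.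
  apply: (HN (`|N| + 1)); last by exists z.
  by rewrite (le_lt_trans (ler_norm N))// ltrDl.
pose psi z := f z * phi' z + g z * phi z.
have ipsi x y : mu.-integrable `[x, y] (EFin \o psi) by apply: integrable_add.
(* H has increments of order (y - x)^2, hence is constant: this replaces the
   product rule for f * phi. *)
pose H x := \int[mu]_(z in `[a, x]) psi z - f x * phi x.
have HC : H c = H a.
  apply: (@quadratic_constant H a c (2 * M * C) (ltW ac)) => x y ax xy yc.
  (* Discrete product rule: [f y * phi y - f x * phi x] equals [phi x * (f y - f x) + f y * (phi y -
     phi x)], and both increments are integrals over [[x, y]]. *)
  have -> : H y - H x = \int[mu]_(z in `[x, y]) (psi z - (phi x * g z + f y * phi' z)).
    rewrite RintegralB//; last first.
      by apply: integrable_add => //; apply: integrable_scale => //; exact: cint.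
    rewrite [X in _ = _ - X]RintegralD//; [|by apply: integrable_scale|
      by apply: integrable_scale => //; exact: cint].
    rewrite !RintegralZl//; last exact: cint.
    rewrite -fg// -phiftc// -(Rintegral_itv_subr ax xy)// /H; ring.
  have -> : 2 * M * C * (y - x) ^+ 2 = (2 * M * C * (y - x)) * (y - x) by ring.
  apply: Rintegral_le_bound => //.
    apply: integrable_sub => //; apply: integrable_add => //; apply: integrable_scale => //.
    exact: cint.
  move=> z /andP[xz zy].
  have -> : psi z - (phi x * g z + f y * phi' z) = g z * (phi z - phi x) - (f y - f z) * phi' z.
    by rewrite /psi; ring.
  have f1 := fM z y zy.
  have p1 := phiL x z ax xz (le_trans zy yc).
  have c1 : `|phi' z| <= C by apply: phiC; rewrite (le_trans ax xz) (le_trans zy yc).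
  apply: le_trans (ler_normB _ _) _; rewrite !normrM.
  have e1 : `|g z| * `|phi z - phi x| <= M * (C * (y - x)).
    apply: ler_pM => //; apply: le_trans p1 _; apply: ler_wpM2l => //; lra.
  have e2 : `|f y - f z| * `|phi' z| <= M * (y - x) * C.
    apply: ler_pM => //; apply: le_trans f1 _; apply: ler_wpM2l => //; lra.
  by apply: le_trans (lerD e1 e2) _; rewrite le_eqVlt; apply/orP; left; apply/eqP; ring.
(* [phi] vanishes at [a] and [c], so [H c = H a] loses its boundary terms. *)
have : \int[mu]_(z in `[a, c]) psi z = 0.
  by move: HC; rewrite /H phia phic !mulr0 !subr0 => ->; rewrite set_itv1 Rintegral_set1.
rewrite RintegralD// => /eqP; rewrite addr_eq0 => /eqP E.
have oc (h : R -> R) : mu.-integrable `[a, c] (EFin \o h) ->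
    \int[mu]_(x in `]a, c[) h x = \int[mu]_(x in `[a, c]) h x.
  move=> ih; rewrite -Rintegral_itv_obnd_cbnd; last first.
    by apply: integrableS ih => // x; rewrite /= !in_itv /= => /andP[/ltW -> ->].
  apply: Rintegral_itv_bndo_bndc.
  by apply: integrableS ih => // x; rewrite /= !in_itv /= => /andP[/ltW -> /ltW ->].
by rewrite !oc.
Qed.

End parts.

(** * Slope energy and essential supremum *)

Section row_vectors.
Context {R : realType} {N : nat}.
Notation V := 'rV[R]_N.

Lemma rV_norm_le (v : V) (M : R) : 0 <= M -> `|v| <= M <-> (forall i, `|v 0 i| <= M).
Proof.
move=> M0; rewrite [`|v|]mx_normrE; split.
  by move=> /bigmax_leP[_ H] i; exact: (H (0, i)).
by move=> H; apply/bigmax_leP; split => // -[i j] _ /=; rewrite (ord1 i).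
Qed.

Lemma rV_cvg (T : Type) (F : set_system T) {FF : Filter F} (f : T -> V) (a : V) :
  (forall i, f x 0 i @[x --> F] --> a 0 i) -> f @ F --> a.
Proof.
move=> H; apply/cvgrPdist_le => e e0.
have : \forall x \near F, forall i, `|a 0 i - f x 0 i| <= e.
  by apply: filter_forall => i; move/cvgrPdist_le : (H i); apply.
apply: filterS => x Hx; apply/rV_norm_le; first exact: ltW.
by move=> i; rewrite !mxE.
Qed.

Lemma rV_bounded_closed_compact (K : set V) (M : R) : closed K ->
  (forall P, K P -> `|P| <= M) -> compact K.
Proof.
move=> cK KM; apply: bounded_closed_compact => //.
by exists M; split; [exact: num_real|move=> M' MM' P /KM H; apply: le_trans H (ltW MM')].
Qed.

Lemma rV_ball_closed (M : R) : closed [set P : V | `|P| <= M].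
Proof.
apply: (@preimage_closed _ _ (fun P : V => `|P|) [set x | x <= M]); last exact: closed_le.
by move=> P _; exact: norm_continuous.
Qed.

Lemma rV_ball_compact (M : R) : compact [set P : V | `|P| <= M].
Proof. by apply: (@rV_bounded_closed_compact _ M) => //; exact: rV_ball_closed. Qed.

Lemma rV_sum_continuous (q : 'I_N -> R -> R) : (forall i, continuous (q i)) ->
  continuous (fun P : V => \sum_(i < N) q i (P 0 i)).
Proof.
move=> cq; elim: (index_enum 'I_N) => [|i r IH].
  rewrite (_ : (fun P : V => _) = cst 0); first exact: cst_continuous.
  by apply/funext => P; rewrite big_nil.
under eq_fun do rewrite big_cons; move=> P; apply: cvgD; [exact: nbhs_filter| |exact: IH].
apply: (@continuous_comp _ _ _ (fun P : V => P 0 i) (q i)); last exact: cq.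
exact: coord_continuous.
Qed.

(** Variational inequality of the Euclidean projection: moving from [k] towards [P] by a fraction
    [h] cannot decrease the distance to [a], whence [2 * h * S <= h ^+ 2 * E]; divide by [h] and let
    it tend to 0. *)
Lemma nearest_point (K : set V) (a : V) : cvx_set K -> compact K -> K !=set0 ->
  exists2 k, K k & forall P, K P -> \sum_(i < N) (a 0 i - k 0 i) * (P 0 i - k 0 i) <= 0.
Proof.
move=> cK comK K0.
pose q (P : V) := \sum_(i < N) (a 0 i - P 0 i) ^+ 2.
have cq : continuous q.
  apply: (@rV_sum_continuous (fun i x => (a 0 i - x) ^+ 2)) => i x.
  apply: (@continuous_comp _ _ _ (fun x => a 0 i - x) (fun y => y ^+ 2)); last exact: exprn_continuous.
  by apply: cvgB; [exact: cvg_cst|exact: cvg_id].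
have [k kK kmin] := compact_EVT_min K0 comK (continuous_subspaceT cq).
rewrite inE in kK; exists k => // P KP.
set S := \sum_(i < N) _; pose E := \sum_(i < N) (P 0 i - k 0 i) ^+ 2.
have E0 : 0 <= E by apply: sumr_ge0 => i _; exact: sqr_ge0.
have key (h : R) : 0 <= h <= 1 -> 2 * h * S <= h ^+ 2 * E.
  move=> h01; have Kh : K (h *: P + (1 - h) *: k) by exact: cK.
  have := kmin _ (mem_set Kh).
  have -> : q (h *: P + (1 - h) *: k) = q k - 2 * h * S + h ^+ 2 * E.
    rewrite /q /S /E !mulr_sumr -sumrB -big_split /=; apply: eq_bigr => i _.
    by rewrite !mxE; ring.
  lra.
apply/ler_addgt0Pr => e e0; rewrite add0r.
(* Ensures both [h <= 1] and [h * E <= e]. *)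
pose h := e / (e + E + 1).
have d0 : 0 < e + E + 1 by lra.
have h0 : 0 < h by rewrite divr_gt0.
have h1 : h <= 1 by rewrite ler_pdivrMr//; lra.
have := key h (ltac:(rewrite (ltW h0) h1 //)).
have hE : h * E <= e by rewrite /h mulrAC ler_pdivrMr//; nra.
have -> : 2 * h * S = h * (2 * S) by ring.
by rewrite expr2 -mulrA ler_pM2l// => ?; lra.
Qed.

End row_vectors.

Section averages.
Context {R : realType} {N : nat}.
Notation V := 'rV[R]_N.
Notation mu := (@lebesgue_measure R).

Lemma Rintegral_sum (I : Type) (r : seq I) (K : set R) (f : I -> R -> R) : measurable K ->
  (forall i, mu.-integrable K (EFin \o f i)) ->
  mu.-integrable K (EFin \o (fun x => \sum_(i <- r) f i x)) /\
  \int[mu]_(x in K) (\sum_(i <- r) f i x) = \sum_(i <- r) \int[mu]_(x in K) f i x.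
Proof.
move=> mK fi; elim: r => [|i r [IH1 IH2]].
  have -> : (fun x : R => \sum_(i <- [::]) f i x) = cst 0.
    by apply/funext => x; rewrite big_nil.
  by split; [exact: integrable0|rewrite big_nil Rintegral_cst// mul0r].
have -> : (fun x : R => \sum_(j <- i :: r) f j x) = (fun x => f i x + \sum_(j <- r) f j x).
  by apply/funext => x; rewrite big_cons.
by split; [exact: integrable_add|rewrite big_cons RintegralD// IH2].
Qed.

(* If k is the point of K nearest to the average a, integrating
   <a - k, g - k> <= 0 gives |a - k|^2 <= 0. *)
Lemma average_in_convex (K : set V) (w : R -> V) (g : R -> V) (s s' : R) :
  cvx_set K -> compact K -> s < s' ->
  (forall i, mu.-integrable `[s, s'] (EFin \o (fun x => g x 0 i))) ->
  (forall i, w s' 0 i - w s 0 i = \int[mu]_(x in `[s, s']) g x 0 i) ->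
  {ae mu, forall x, s <= x <= s' -> K (g x)} -> K (slope w s s').
Proof.
move=> cK comK ss' ig wg Kg.
have mI : measurable (`[s, s']%classic : set R) by exact: measurable_itv.
(* Were [K] empty, the hypothesis would make the whole interval negligible. *)
have K0 : K !=set0.
  apply: contrapT => nK.
  have neg : mu.-negligible `[s, s'].
    apply: negligibleS Kg => x; rewrite /= in_itv /= => xs H; apply: nK.
    by exists (g x); exact: H.
  have := @measure_negligible _ _ _ mu `[s, s']%classic mI neg.
  rewrite [LHS](lebesgue_measure_itv `[s, s']) /= lte_fin ss'.
  by move=> /eqP; rewrite -EFinB eqe subr_eq0 gt_eqF.
set a := slope w s s'.
have [k Kk kP] := nearest_point a cK comK K0.
suff -> : a = k by [].
pose c i := a 0 i - k 0 i.
have icst (r : R) : mu.-integrable `[s, s'] (EFin \o (fun=> r)).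
  apply: continuous_compact_integrable; first exact: segment_compact.
  by apply: continuous_subspaceT => z; exact: cvg_cst.
have ii i : mu.-integrable `[s, s'] (EFin \o (fun x => c i * (g x 0 i - k 0 i))).
  by apply: integrable_scale => //; exact: integrable_sub.
have [iS ES] := Rintegral_sum (index_enum 'I_N) mI ii.
have le0 : \int[mu]_(x in `[s, s']) (\sum_(i <- index_enum 'I_N) c i * (g x 0 i - k 0 i)) <= 0.
  pose F x := \sum_(i <- index_enum 'I_N) c i * (g x 0 i - k 0 i).
  have /integrableP[mF _] := iS.
  (* The integrand is nonpositive only almost everywhere; its minimum with 0 has the same integral
     and is nonpositive everywhere. *)
  have mF0 : measurable_fun `[s, s']%classic (fun x => Num.min (F x) 0).
    by apply: measurable_minr => //; exact/measurable_EFinP.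
  have iF0 : mu.-integrable `[s, s'] (EFin \o (fun x => Num.min (F x) 0)).
    apply: le_integrable iS => //; first exact/measurable_EFinP.
    move=> x _; rewrite lee_fin -/(F x); have [Fx|Fx] := leP (F x) 0; first by [].
    by rewrite normr0.
  have -> : \int[mu]_(x in `[s, s']) F x = \int[mu]_(x in `[s, s']) Num.min (F x) 0.
    rewrite /Rintegral; congr fine; apply: ae_eq_integral => //.
      exact/measurable_EFinP.
    apply: ae_imply Kg => x Kx; rewrite /= in_itv /= => /Kx /kP Fx.
    by rewrite min_l.
  have I0 : \int[mu]_(x in `[s, s']) (0 : R) = 0 by rewrite Rintegral_cst// mul0r.
  rewrite -[leRHS]I0.
  by apply: le_Rintegral => // x _; rewrite ge_min lexx orbT.
have : (s' - s) * \sum_(i < N) c i ^+ 2 <= 0.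
  apply: le_trans le0; rewrite ES mulr_sumr le_eqVlt; apply/orP; left; apply/eqP.
  apply: eq_bigr => i _; rewrite RintegralZl//; last exact: integrable_sub.
  rewrite RintegralB// -wg Rintegral_cst_itv ?ltW//.
  have -> : w s' 0 i - w s 0 i = (s' - s) * a 0 i.
    by rewrite /a /slope !mxE mulrA mulfV ?mul1r// subr_eq0 gt_eqF.
  by rewrite /c; ring.
have S0 : 0 <= \sum_(i < N) c i ^+ 2 by apply: sumr_ge0 => i _; exact: sqr_ge0.
have ss0 : 0 < s' - s by rewrite subr_gt0.
rewrite pmulr_rle0// => le0'.
have /eqP : \sum_(i < N) c i ^+ 2 = 0 by apply/le_anti; rewrite S0 le0'.
rewrite psumr_eq0; last by move=> i _; exact: sqr_ge0.
move=> /allP H; apply/rowP => i; apply/eqP; rewrite -subr_eq0.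
by have := H i (mem_index_enum i); rewrite /= sqrf_eq0.
Qed.

End averages.

Section weak_energy.
Context {R : realType} {N : nat}.
Notation V := 'rV[R]_N.
Notation mu := (@lebesgue_measure R).
Variable L : R -> V -> V -> R.
Hypothesis HL : lagrangian L.
Implicit Types (w g : R -> V).

Lemma sublevel_closed (x : R) (a : V) (t : R) : closed [set P | L x a P <= t].
Proof.
apply: (@preimage_closed _ _ (fun P : V => L x a P) [set y | y <= t]); last exact: closed_le.
move=> P _; apply: (@cvg_comp _ _ _ (fun P => (x, a, P)) _ _ _ _ _ (@lag_continuous _ _ _ HL (x, a, P))).
by apply: (cvg_pair (cvg_pair (cvg_cst _) (cvg_cst _)) cvg_id); exact: nbhs_filter.
Qed.

Lemma sublevel_compact (x : R) (a : V) (t : R) : compact [set P | L x a P <= t].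
Proof.
have [M M0 HM] := lag_coercive HL t.
apply: (@rV_bounded_closed_compact _ _ _ M); first exact: sublevel_closed.
by move=> P; exact: HM.
Qed.

(** Jensen's inequality for a level-convex integrand: over a short interval [(z, w z)] is frozen at
    [(s, w s)], so almost every [g z] lies in one compact convex sublevel set, and so does their
    average, the slope. A first pass with a ball as the convex set gives the Lipschitz bound that
    freezing needs. *)
Lemma weak_energy_le w g (a c t : R) : a < c -> {within `[a, c], continuous w} ->
  (forall i s s', a < s -> s < s' -> s' < c -> mu.-integrable `[s, s'] (EFin \o (fun x => g x 0 i))) ->
  (forall i s s', a < s -> s < s' -> s' < c -> w s' 0 i - w s 0 i = \int[mu]_(x in `[s, s']) g x 0 i) ->
  {ae mu, forall z, a < z < c -> L z (w z) (g z) <= t} -> energy_le L w a c t.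
Proof.
move=> ac cw ig wg Lg; apply: (energy_interior HL cw) => e e0.
have [M M0 HM] := lag_coercive HL t.
have wM s s' : a < s -> s < s' -> s' < c -> `|w s' - w s| <= M * (s' - s).
  move=> as_ ss' s'c; apply/(slope_norm _ _ ss').
  apply: (@average_in_convex _ _ [set P : V | `|P| <= M] w g) => //.
  - exact: cvx_ball.
  - exact: rV_ball_compact.
  - by move=> i; exact: ig.
  - by move=> i; exact: wg.
  - apply: ae_imply Lg => z Lz /andP[sz zs']; apply: (HM z (w z)); apply: Lz.
    by rewrite (lt_le_trans as_ sz) (le_lt_trans zs' s'c).
have [B HB] : exists B : R, forall x, a <= x <= c -> `|w x| <= B.
  have := continuous_compact cw (@segment_compact _ a c).
  move=> /compact_bounded[B [_ HB]]; exists (`|B| + 1) => x xac.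
  apply: (HB (`|B| + 1)); last by exists x => //; rewrite /= in_itv.
  by rewrite (le_lt_trans (ler_norm B))// ltrDl.
pose B' := Num.max (Num.max (`|a| + `|c|) B) M.
have [d d0 Hd] := lag_unif HL B' e0.
have dM : 0 < d / (M + 1) by rewrite divr_gt0//; lra.
exists (Num.min d (d / (M + 1))); first by rewrite lt_min d0 dM.
move=> s s' as_ ss' s'c; rewrite lt_min => /andP[sd sdM].
apply: (@average_in_convex _ _ [set P | L s (w s) P <= t + e] w g) => //.
- exact: lag_convex.
- exact: sublevel_compact.
- by move=> i; exact: ig.
- by move=> i; exact: wg.
apply: ae_imply Lg => z Lz /andP[sz zs'] /=.
have {}Lz : L z (w z) (g z) <= t by apply: Lz; rewrite (lt_le_trans as_ sz) (le_lt_trans zs' s'c).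
have zB : `|z| <= B'.
  rewrite /B' !le_max; apply/orP; left; apply/orP; left.
  have := ler_norm c; have := ler_norm (- a); rewrite normrN => h1 h2.
  have := normr_ge0 a; have := normr_ge0 c => *.
  by rewrite ler_norml; apply/andP; split; lra.
have wB : `|w z| <= B'.
  rewrite /B' !le_max; apply/orP; left; apply/orP; right; apply: HB.
  by apply/andP; split; lra.
have gB : `|g z| <= B' by rewrite /B' le_max (HM _ _ _ Lz) orbT.
have zs : `|z - s| < d by rewrite ger0_norm; lra.
have wzs : `|w z - w s| < d.
  move: sz; rewrite le_eqVlt => /predU1P[->|sz]; first by rewrite subrr normr0.
  apply: le_lt_trans (wM s z as_ sz (le_lt_trans zs' s'c)) _.
  by move: sdM; rewrite ltr_pdivlMr; [nra|lra].
have := Hd z s (w z) (w s) (g z) (g z) zB wB gB zs wzs.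
rewrite subrr normr0 => /(_ d0); rewrite ltr_norml => /andP[? ?]; lra.
Qed.

(** The reverse passage: slopes over [[z, z + h]] tend to the derivative [P], and [L] is
    continuous. *)
Lemma energy_le_derive w (P : V) (a c t z : R) : a < z < c ->
  (forall i, is_derive z 1 (fun x => w x 0 i) (P 0 i)) ->
  energy_le L w a c t -> L z (w z) P <= t.
Proof.
move=> /andP[az zc] wP Hw; apply/ler_addgt0Pr => e e0.
have [d d0 Hd] := Hw e e0.
apply: (@L_lim_le _ _ _ HL _ (0^'+) _ (fun=> z) (fun=> w z) (fun h => slope w z (h + z))).
- exact: cvg_cst.
- exact: cvg_cst.
- apply: rV_cvg => i; have [dw dE] := wP i.
  rewrite -dE.
  have : h^-1 *: (((fun x => w x 0 i) \o shift z) (h *: (1 : R)) - w z 0 i) @[h --> 0^'] -->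
    'D_1 (fun x => w x 0 i) z.
    exact: dw.
  have sub : (0 : R)^'+ `=>` 0^'.
    by move=> A; rewrite /dnbhs /at_right /within /=; apply: filterS => x H x0; apply: H; rewrite gt_eqF.
  move=> /(cvg_trans (cvg_app _ sub)); apply: cvg_trans.
  apply: near_eq_cvg; near=> h.
  by rewrite /slope !mxE addrK /= [h *: 1]mulr1.
near=> h.
have h0 : 0 < h by near: h; exact: nbhs_right_gt.
apply: Hd; rewrite ?addrK.
- exact: ltW.
- by rewrite ltrDr.
- by rewrite -lerBrDr ltW//; near: h; apply: nbhs_right_lt; rewrite subr_gt0.
- by near: h; exact: nbhs_right_lt.
Unshelve. all: by end_near. Qed.

End weak_energy.

(** * Existence of absolute minimisers *)

Section euclidean_norm.
Context {R : realType} {N : nat}.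
Implicit Types v : 'rV[R]_N.

Lemma norm_le_eucl_norm v : `|v| <= eucl_norm v.
Proof.
apply/rV_norm_le; first exact: sqrtr_ge0.
move=> i; rewrite -sqrtr_sqr ler_sqrt; last by apply: sumr_ge0 => j _; exact: sqr_ge0.
by rewrite (bigD1 i)//= lerDl; apply: sumr_ge0 => j _; exact: sqr_ge0.
Qed.

Lemma eucl_norm_le v (B : R) : (forall i, `|v 0 i| <= B) ->
  eucl_norm v <= Num.sqrt (N%:R * B ^+ 2).
Proof.
move=> vB; rewrite /eucl_norm ler_sqrt; last by rewrite mulr_ge0// sqr_ge0.
have -> : N%:R * B ^+ 2 = \sum_(i < N) B ^+ 2 by rewrite sumr_const card_ord mulr_natl.
apply: ler_sum => i _; rewrite -(real_normK (num_real (v 0 i))).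
by rewrite ler_pXn2r ?nnegrE//; apply: le_trans (vB i).
Qed.

End euclidean_norm.

Lemma closure_itvoo (R : realType) (a c x : R) : a < c ->
  closure `]a, c[ x <-> a <= x <= c.
Proof.
move=> ac; split.
  have sub : closure `]a, c[ `<=` `[a, c].
    rewrite [X in _ `<=` X](closure_id _).1; last exact: itv_closed.
    by apply: closureS => y; rewrite /= !in_itv /= => /andP[/ltW -> /ltW ->].
  by move=> /sub; rewrite /= in_itv.
move=> /andP[ax xc] A /nbhs_ballP[r /= r0 rA].
pose m := (a + c) / 2.
pose k := Num.min (r / (c - a)) 1 / 2.
have r1 : 0 < r / (c - a) by rewrite divr_gt0// subr_gt0.
have m0 : 0 < Num.min (r / (c - a)) 1 by rewrite lt_min r1 ltr01.
have m1 : Num.min (r / (c - a)) 1 <= 1 by rewrite ge_min lexx orbT.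
have m2 : Num.min (r / (c - a)) 1 <= r / (c - a) by rewrite ge_min lexx.
have k0 : 0 < k by rewrite /k; lra.
have k1 : k < 1 by rewrite /k; lra.
have kr : k * (c - a) < r.
  by rewrite -ltr_pdivlMr ?subr_gt0// /k; lra.
exists (x + k * (m - x)); split.
  by rewrite /= in_itv /= /m; apply/andP; split; nra.
apply: rA; rewrite /ball /= opprD addrA subrr add0r normrN normrM (gtr0_norm k0).
apply: le_lt_trans kr; apply: ler_wpM2l; first exact: ltW.
by rewrite /m ler_norml; apply/andP; split; lra.
Qed.

Section uniform_continuity.
Context {R : realType} {N : nat}.
Notation V := 'rV[R]_N.

(** Heine-Cantor with only the first point confined to the compact set [K]; the second may leave
    it. *)
Lemma uniform_on_bounded (F : R * V * V -> R) : continuous F ->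
  forall B e : R, 0 < e -> exists2 d : R, 0 < d &
    forall s s' a a' P P', `|s| <= B -> `|a| <= B -> `|P| <= B ->
      `|s - s'| < d -> `|a - a'| < d -> `|P - P'| < d ->
      `|F (s, a, P) - F (s', a', P')| < e.
Proof.
move=> cF B e e0.
pose K : set (R * V * V) := (`[- B, B] `*` [set a : V | `|a| <= B]) `*` [set P : V | `|P| <= B].
have cK : compact K.
  apply: compact_setX; last exact: rV_ball_compact.
  by apply: compact_setX; [exact: segment_compact|exact: rV_ball_compact].
pose good (d : R) (p : R * V * V) := forall p', ball p d p' -> `|F p - F p'| < e.
have cover : \forall d \near (0 : R)^'+, K `<=` good d.
  apply: (compact_near_coveringP _).1 cK _ _ _ _ _ => p Kp.
  have /cvgrPdist_lt /(_ (e / 2)) : F x @[x --> p] --> F p by exact: cF.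
  move=> /(_ (ltac:(lra))) /nbhs_ballP[r /= r0 Hr].
  exists (ball p (r / 2), [set d | 0 < d < r / 2]).
    split; first by apply: nbhsx_ballx; lra.
    near=> d; apply/andP; split; near: d; first exact: nbhs_right_gt.
    by apply: nbhs_right_lt; lra.
  move=> [q d] [/= pq /andP[d0 dr]] q' qq'.
  have r2r : r / 2 <= r by lra.
  have h1 : `|F p - F q| < e / 2 by apply: Hr; exact: le_ball pq.
  have pq' : ball p r q'.
    rewrite (splitr r); apply: ball_triangle pq _; apply: le_ball qq'; exact: ltW.
  have h2 : `|F p - F q'| < e / 2 by exact: Hr.
  have := ler_distD (F p) (F q) (F q'); rewrite (distrC (F q) (F p)); lra.
have [d d0 Hd] : exists2 d : R, 0 < d & K `<=` good d.
  near (0 : R)^'+ => d; exists d; near: d => //; exact: nbhs_right_gt.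
exists d => // s s' a a' P P' sB aB PB ss' aa' PP'.
have b1 : ball s d s' by rewrite -ball_normE.
have b2 : ball a d a' by rewrite -ball_normE.
have b3 : ball P d P' by rewrite -ball_normE.
have Kp : K (s, a, P) by split => //; split => //; rewrite /= in_itv /= -ler_norml.
exact: Hd (s, a, P) Kp (s', a', P') (conj (conj b1 b2) b3).
Unshelve. all: by end_near. Qed.

End uniform_continuity.

(** * Extension of the Lagrangian to the whole line *)

Section clamped_lagrangian.
Context {R : realType} {N : nat}.
Notation V := 'rV[R]_N.
Variables (alpha beta : R) (L : R -> V -> V -> R).
Hypothesis ab : alpha < beta.
Notation I := (closure `]alpha, beta[).
Hypothesis L_ge0 : forall x eta P, I x -> 0 <= L x eta P.
Hypothesis L_cont : {within I `*` [set: V] `*` [set: V],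
  continuous (fun z : R * V * V => L z.1.1 z.1.2 z.2)}.
Hypothesis L_lconvex : forall x eta, I x -> level_convex (L x eta).
Variables (C1 C2 q : R).
Hypotheses (C1_gt0 : 0 < C1) (q_gt0 : 0 < q).
Hypothesis L_coercive : forall x eta P, I x -> C1 * eucl_norm P `^ q - C2 <= L x eta P.

(** The assumptions on [L] concern only [x] in the closed interval; clamping [x] makes them global
    and changes no value there. *)
Definition clamped x := L (clamp alpha beta x).

Lemma clamp_closure x : I (clamp alpha beta x).
Proof. by apply/closure_itvoo => //; apply: clamp_itv; exact: ltW. Qed.

Lemma clamp_continuous : continuous (clamp alpha beta).
Proof.
apply: (@lipschitz_continuous _ _ _ 1) => s s' ss'.
by rewrite mul1r ger0_norm ?subr_ge0 ?clamp_mono// clampB.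
Qed.

Lemma clamped_continuous : continuous (fun z : R * V * V => clamped z.1.1 z.1.2 z.2).
Proof.
move=> z.
pose z' : R * V * V := (clamp alpha beta z.1.1, z.1.2, z.2).
pose A := I `*` [set: V] `*` [set: V].
have Az' : A z' by split => //; split => //; exact: clamp_closure.
have Lz' : (fun y : R * V * V => L y.1.1 y.1.2 y.2) @ within A (nbhs z') --> L z'.1.1 z'.1.2 z'.2.
  by have := @L_cont z'; rewrite /continuous_at /= nbhs_subspace_in.
apply: (@cvg_comp _ _ _ (fun y : R * V * V => (clamp alpha beta y.1.1, y.1.2, y.2)) _ _
  (within A (nbhs z'))) Lz'.
have cz : (clamp alpha beta y.1.1, y.1.2, y.2) @[y --> z] --> z'.
  have z11 : y.1.1 @[y --> z] --> z.1.1 by apply: (@cvg_comp _ _ _ fst fst _ (nbhs z.1)); exact: cvg_fst.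
  have z12 : y.1.2 @[y --> z] --> z.1.2.
    by apply: (@cvg_comp _ _ _ fst snd _ (nbhs z.1)); [exact: cvg_fst|exact: cvg_snd].
  have z2 : y.2 @[y --> z] --> z.2 by exact: cvg_snd.
  exact: (cvg_pair (cvg_pair (cvg_comp _ _ z11 (@clamp_continuous z.1.1)) z12) z2).
move=> P /cz; apply: (@filterS _ (nbhs z)) => y /=; apply.
by split => //; split => //; exact: clamp_closure.
Qed.

(** Level-convexity speaks of levels [t >= 0]; for the others the sublevel set has no point, as [L]
    is nonnegative. *)
Lemma level_convex_cvx (x : R) (a : V) (t : R) : I x -> cvx_set [set P | L x a P <= t].
Proof.
move=> Ix k P Q /andP[k0 k1] /= HP HQ.
have t0 : 0 <= t by apply: le_trans HP; exact: L_ge0.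
have := L_lconvex Ix t0 (Itv01 k0 k1) (mem_set HP) (mem_set HQ).
by rewrite inE.
Qed.

Lemma coercive_bound T : exists2 M : R, 0 <= M & forall x a P, I x -> L x a P <= T -> `|P| <= M.
Proof.
exists ((`|T + C2| / C1) `^ q^-1); first exact: powR_ge0.
move=> x a P Ix LT; apply: le_trans (norm_le_eucl_norm P) _.
have P0 : 0 <= eucl_norm P by exact: sqrtr_ge0.
have -> : eucl_norm P = (eucl_norm P `^ q) `^ q^-1.
  by rewrite -powRrM mulfV ?gt_eqF// powRr1.
apply: ge0_ler_powR; rewrite ?nnegrE ?powR_ge0 ?invr_ge0 ?divr_ge0 ?(ltW q_gt0) ?(ltW C1_gt0)//.
rewrite ler_pdivlMr// mulrC; have := L_coercive a P Ix; have := ler_norm (T + C2); lra.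
Qed.

Lemma clamped_lagrangian : lagrangian clamped.
Proof.
split.
- by move=> x a P; apply: L_ge0; exact: clamp_closure.
- by move=> x a t; apply: level_convex_cvx; exact: clamp_closure.
- move=> T; have [M M0 HM] := coercive_bound T; exists M => // x a P.
  by apply: HM; exact: clamp_closure.
- move=> B e e0; have [d d0 Hd] := uniform_on_bounded clamped_continuous B e0.
  by exists d => // s s' a a' P P' *; exact: (Hd s s' a a' P P').
- exact: clamped_continuous.
Qed.

End clamped_lagrangian.

Section weak_derivative_operations.
Context {R : realType}.
Let mu := @lebesgue_measure R.
Implicit Types (U : set R) (f g : R -> R).

Lemma test_functionS U U' phi : U' `<=` U -> test_function U' phi -> test_function U phi.
Proof. by move=> U'U [? ? ? sub]; split => //; apply: subset_trans sub U'U. Qed.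

Lemma test_function_support U phi : test_function U phi ->
  forall x, ~ (closure [set y | phi y != 0]) x -> phi x = 0 /\ derive1 phi x = 0.
Proof.
move=> [_ _ _ _] x Kx; have : nbhs x (~` closure [set y | phi y != 0]).
  by apply: open_nbhs_nbhs; split => //; apply: closed_openC; exact: closed_closure.
have phi0 y : (~` closure [set y | phi y != 0]) y -> phi y = 0.
  move=> Ky; apply/eqP; apply: contra_notT Ky => y0.
  by apply: subset_closure.
move=> nx; split; first exact: phi0.
rewrite derive1E (@near_eq_derive _ _ _ phi (cst 0))//.
  by rewrite derive_cst.
by apply: filterS nx => y /phi0.
Qed.

Lemma weak_derivative1S U U' f g : open U' -> U' `<=` U ->
  weak_derivative1 U f g -> weak_derivative1 U' f g.
Proof.
move=> oU' U'U [lf lg fg].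
have loc h : locally_integrable U h -> locally_integrable U' h.
  move=> [mh oU hK]; split => //.
    by apply: measurable_funS mh => //; exact: open_measurable.
  by move=> K KU'; apply: hK; exact: subset_trans U'U.
split; [exact: loc|exact: loc|] => phi tphi.
have := fg phi (test_functionS U'U tphi).
have [_ _ _ sub] := tphi; have supp := test_function_support tphi.
pose K := closure [set y | phi y != 0].
rewrite !(@Rintegral_support _ U K); last 4 first.
- exact: subset_trans U'U.
- by move=> x /supp[-> _]; rewrite mulr0.
- exact: subset_trans U'U.
- by move=> x /supp[_ ->]; rewrite mulr0.
rewrite !(@Rintegral_support _ U' K)//.
- by move=> x /supp[-> _]; rewrite mulr0.
- by move=> x /supp[_ ->]; rewrite mulr0.
Qed.

(** Splitting an integral requires integrability, granted only on compact sets; the integrals are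
    therefore first cut down to the support of [phi]. *)
Lemma weak_derivative1D U f1 g1 f2 g2 : weak_derivative1 U f1 g1 ->
  weak_derivative1 U f2 g2 -> weak_derivative1 U (f1 \+ f2) (g1 \+ g2).
Proof.
move=> [lf1 lg1 fg1] [lf2 lg2 fg2]; split; [exact: locally_integrableD|exact: locally_integrableD|].
move=> phi tphi; have supp := test_function_support tphi.
have [dphi cphi' cK KU] := tphi.
have mU : measurable U by apply: open_measurable; have [] := lf1.
pose K := closure [set y | phi y != 0].
have mK : measurable K by apply: closed_measurable; exact: closed_closure.
have cphi : continuous phi.
  by move=> x; apply: differentiable_continuous; apply/derivable1_diffP.
have bounded_on_K (psi : R -> R) : continuous psi -> exists C : R, forall x, K x -> `|psi x| <= C.
  move=> cpsi; have /compact_bounded[C [_ HC]] : compact (psi @` K).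
    by apply: continuous_compact => //; exact: continuous_subspaceT.
  exists (C + 1) => x Kx; apply: HC; first by rewrite ltrDl.
  by exists x.
have ibl f psi : locally_integrable U f -> continuous psi ->
    mu.-integrable K (EFin \o (fun x => f x * psi x)).
  move=> lf cpsi; have [C HC] := bounded_on_K psi cpsi.
  apply: (integrable_bounded_mul mK _ _ HC); first exact: locally_integrable_compact lf _ _.
  exact: continuous_measurable_on.
have splitK f h psi : locally_integrable U f -> locally_integrable U h -> continuous psi ->
    (forall x, ~ K x -> psi x = 0) ->
    \int[mu]_(x in U) ((f \+ h) x * psi x) =
    \int[mu]_(x in U) (f x * psi x) + \int[mu]_(x in U) (h x * psi x).
  move=> lf lh cpsi psi0.
  rewrite !(@Rintegral_support _ U K) => //; try by move=> x /psi0 ->; rewrite mulr0.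
  rewrite -RintegralD//; [|exact: ibl|exact: ibl].
  by congr (Rintegral _ _ _); apply/funext => x; rewrite /= mulrDl.
rewrite splitK//; last by move=> x /supp[].
rewrite splitK//; last by move=> x /supp[].
by rewrite fg1// fg2// opprD.
Qed.

End weak_derivative_operations.

(** * Reduction of open sets to their components *)

Section open_components.
Context {R : realType}.
Implicit Types U : set R.

Lemma open_right_end U (q hi : R) : open U -> U q -> (forall y, U y -> y < hi) ->
  exists r : R, [/\ q < r, ~ U r & forall y, q <= y < r -> U y].
Proof.
move=> oU Uq Uhi; pose A := [set y | q <= y /\ ~ U y].
have qhi := Uhi _ Uq.
have A0 : A !=set0 by exists hi; split; [exact: ltW|move=> /Uhi; rewrite ltxx].
have Alb : lbound A q by move=> y [].
have iA : has_inf A by split => //; exists q.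
have nUr : ~ U (inf A).
  move=> Ur; have /nbhs_ballP[e e0 eU] : nbhs (inf A) U by exact: open_nbhs_nbhs.
  have [y [qy nUy] yr] := inf_adherent e0 iA.
  have ry : inf A <= y by apply: ge_inf => //; exists q.
  by apply: nUy; apply: eU; rewrite /ball /= ltr_distlC; apply/andP; split; lra.
exists (inf A); split => //.
- rewrite lt_neqAle; apply/andP; split; last exact: lb_le_inf.
  by apply/eqP => qr; apply: nUr; rewrite -qr.
- move=> y /andP[qy yr]; apply: contrapT => nUy.
  have : inf A <= y by apply: ge_inf => //; exists q.
  by rewrite leNgt yr.
Qed.

Lemma open_component U (q lo hi : R) : open U -> U q -> (forall y, U y -> lo < y < hi) ->
  exists p r : R, [/\ p < q < r, ~ U p, ~ U r & `]p, r[ `<=` U].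
Proof.
move=> oU Uq Ub.
have [|r [qr nUr Ur]] := @open_right_end U q hi oU Uq; first by move=> y /Ub/andP[].
(* The left end is the right end of the reflected set. *)
have [|||p [qp nUp Up]] := @open_right_end (-%R @^-1` U) (- q) (- lo).
- by apply: open_comp => // x _; exact: opp_continuous.
- by rewrite /= opprK.
- by move=> y /Ub/andP[]; rewrite ltrNr.
exists (- p), r; split => //.
- by rewrite ltrNl qp qr.
- move=> y; rewrite /= in_itv/= => /andP[py yr].
  have [qy|yq] := leP q y; first by apply: Ur; rewrite qy.
  by have := Up (- y); rewrite /= opprK; apply; rewrite lerN2 (ltW yq)/= ltrNl.
Qed.

(** Each component contains a rational, so the exceptional sets of the components form a countable
    family of null sets. *)
Lemma ae_open_components U (P : R -> Prop) (lo hi : R) : open U ->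
  (forall y, U y -> lo < y < hi) ->
  (forall p r, p < r -> ~ U p -> ~ U r -> `]p, r[ `<=` U ->
     {ae @lebesgue_measure R, forall z, p < z < r -> P z}) ->
  {ae @lebesgue_measure R, forall z, U z -> P z}.
Proof.
move=> oU Ub UP.
have cover (q : rat) : {ae @lebesgue_measure R, forall z, U (ratr q) -> bigcup_ointsub U q z -> P z}.
  have [Uq|nUq] := pselect (U (ratr q)); last by apply: aeW => z /nUq.
  have [p [r [/andP[pq qr] nUp nUr prU]]] := open_component oU Uq Ub.
  apply: ae_imply (UP p r (lt_trans pq qr) nUp nUr prU) => z Pz _ [B [[oB iB BU] Bq] Bz].
  (* If [z <= p], the interval [B] inside [U] joins [z] to the rational and so contains [p], which
     lies outside [U]; likewise for [r]. *)
  apply: Pz; apply/andP; split; rewrite ltNge; apply/negP => le.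
  - apply: nUp; apply: BU; apply: (iB z (ratr q)) => //.
    by rewrite le (ltW pq).
  - apply: nUr; apply: BU; apply: (iB (ratr q) z) => //.
    by rewrite le (ltW qr).
(* The rationals are enumerated through [unpickle]; integers coding none impose nothing. *)
have : {ae @lebesgue_measure R, forall z, forall n : nat,
    if unpickle n is Some q then U (ratr q) -> bigcup_ointsub U q z -> P z else True}.
  apply: ae_foralln => n; case: (unpickle n) => [q|]; last exact: aeW.
  exact: cover.
apply: ae_imply => z H Uz.
have : (\bigcup_(q in [set q | ratr q \in U]) bigcup_ointsub U q) z.
  by rewrite -open_bigcup_rat.
move=> [q /= Uq zq]; have := H (pickle q); rewrite pickleK; apply => //.
by rewrite inE in Uq.
Qed.

End open_components.

Section weak_energy.
Context {R : realType} {N : nat}.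
Let mu := @lebesgue_measure R.
Variable L : R -> 'rV[R]_N -> 'rV[R]_N -> R.
Hypothesis HL : lagrangian L.
Implicit Types (U : set R) (f g w u : R -> 'rV[R]_N).

Lemma within_itv_component w (p r : R) : {within `[p, r], continuous w} ->
  forall i : 'I_N, {in `]p, r[, continuous (fun x => w x 0 i)}.
Proof.
move=> cw i; have : {within `]p, r[, continuous w}.
  by apply: continuous_subspaceW cw; exact: subset_itv_oo_cc.
rewrite continuous_open_subspace; last exact: itv_open.
move=> cw' x xpr; apply: (@continuous_comp _ _ _ w (fun v : 'rV[R]_N => v 0 i)); last exact: coord_continuous.
by apply: cw'; rewrite inE.
Qed.

Lemma ae_energy_le U f g w (p r t : R) : p < r -> `]p, r[ `<=` U -> weak_derivative U f g ->
  {ae mu, forall x, U x -> w x = f x} -> {within `[p, r], continuous w} ->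
  {ae mu, forall x, U x -> L x (f x) (g x) <= t} -> energy_le L w p r t.
Proof.
move=> pr prU fg wf cw Lt.
have wfi i : {ae mu, forall x, U x -> w x 0 i = f x 0 i}.
  by apply: ae_imply wf => x H /H ->.
apply: (weak_energy_le HL (g := g)) => //.
- move=> i s s' ps ss' s'r; have [_ lg _] := fg i.
  apply: (locally_integrable_compact lg); last exact: segment_compact.
  apply: subset_trans prU => x; rewrite /= !in_itv/= => /andP[sx xs'].
  by rewrite (lt_le_trans ps sx) (le_lt_trans xs' s'r).
- move=> i s s' ps ss' s'r.
  exact: (weak_derivative1_ftc (fg i) prU (wfi i) (within_itv_component cw (i := i)) ps (ltW ss') s'r).
- apply: ae_imply2 wf Lt => x wx Lx pxr.
  have Ux : U x by apply: prU; rewrite /= in_itv.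
  by rewrite wx//; exact: Lx.
Qed.

(** The weak derivative is the classical one almost everywhere, and the coordinates are finitely
    many, so [energy_le_derive] applies at almost every point. *)
Lemma energy_le_ae U u g (p r t : R) : p < r -> `]p, r[ `<=` U -> weak_derivative U u g ->
  continuous u -> energy_le L u p r t ->
  {ae mu, forall z, p < z < r -> L z (u z) (g z) <= t}.
Proof.
move=> pr prU ug cu Eu.
have di i : {ae mu, forall z, p < z < r ->
    is_derive z 1 (fun x => u x 0 i) (g z 0 i)}.
  apply: (weak_derivative1_is_derive_ae pr (ug i) prU).
  - exact: aeW.
  - by apply: within_itv_component; exact: continuous_subspaceT.
have : {ae mu, forall z, forall i, p < z < r -> is_derive z 1 (fun x => u x 0 i) (g z 0 i)}.
  by have := filter_forall (ae_filter_ringOfSetsType mu) di.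
by apply: ae_imply => z dz pzr; apply: (energy_le_derive HL pzr) => // i; exact: dz.
Qed.

End weak_energy.

Section lipschitz_sobolev.
Context {R : realType} {N : nat}.
Let mu := @lebesgue_measure R.
Implicit Types (U : set R) (f g u : R -> 'rV[R]_N).

Lemma coord_norm_le (v : 'rV[R]_N) i : `|v 0 i| <= `|v|.
Proof. exact: (rV_norm_le v (normr_ge0 v)).1. Qed.

Lemma bounded_Loo U f (M : R) : (forall i, measurable_fun U (fun x => f x 0 i)) ->
  (forall x i, U x -> `|f x 0 i| <= M) -> Loo U f.
Proof.
move=> mf fM; split => //.
apply: (@le_lt_trans _ _ (Num.sqrt (N%:R * M ^+ 2))%:E); last exact: ltry.
apply/ess_supP; apply: aeW => x; rewrite /patch; case: ifPn => [|_]; last exact: leNye.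
by rewrite inE => Ux; rewrite lee_fin; apply: eucl_norm_le => i; exact: fM.
Qed.

Lemma lipschitz_weak_derivative f (M a c : R) : a < c ->
  (forall s s', s <= s' -> `|f s' - f s| <= M * (s' - s)) ->
  exists g, [/\ weak_derivative `]a, c[ f g,
    forall i, measurable_fun setT (fun x => g x 0 i) & forall x i, `|g x 0 i| <= M].
Proof.
move=> ac fM.
have fMi i s s' : s <= s' -> `|f s' 0 i - f s 0 i| <= M * (s' - s).
  move=> ss'; apply: le_trans (fM s s' ss'); have -> : f s' 0 i - f s 0 i = (f s' - f s) 0 i by rewrite !mxE.
  exact: coord_norm_le.
have /choice[g Hg] : forall i, exists g : R -> R, [/\ measurable_fun setT g,
    forall x, `|g x| <= M & weak_derivative1 `]a, c[ (fun x => f x 0 i) g].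
  move=> i; have [g [mg gM fg]] := lipschitz_density ac (fMi i).
  by exists g; split => //; exact: (lipschitz_weak_derivative1 ac (fMi i)).
exists (fun x => \row_i g i x).
have rowE i : (fun x => (\row_i g i x : 'rV[R]_N) 0 i) = g i by apply/funext => x; rewrite mxE.
split => i.
- by have [_ _] := Hg i; rewrite /weak_derivative1 -(rowE i).
- by have [mg _ _] := Hg i; rewrite rowE.
- by move=> j; rewrite mxE; have [_ + _] := Hg j; apply.
Qed.

Lemma lipschitz_W1oo0 f (M a c : R) : a < c ->
  (forall s s', s <= s' -> `|f s' - f s| <= M * (s' - s)) -> f a = 0 -> f c = 0 ->
  W1oo0 `]a, c[ f.
Proof.
move=> ac fM fa fc; have cf : continuous f := @lipschitz_continuous _ _ f M fM.
have [g [fg mg gM]] := lipschitz_weak_derivative ac fM.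
have cfi i : continuous (fun x => f x 0 i).
  by move=> x; apply: (@continuous_comp _ _ _ f (fun v : 'rV[R]_N => v 0 i));
    [exact: cf|exact: coord_continuous].
split; last first.
  exists f; split; [exact: aeW|exact: continuous_subspaceT|].
  move=> x [/(closure_itvoo _ ac) /andP[ax xc]]; rewrite /= in_itv/= => nx.
  have [->|xa] := eqVneq x a => //; have [->|xc'] := eqVneq x c => //.
  by case: nx; rewrite !lt_neqAle ax xc eq_sym xa xc'.
have mac : measurable `]a, c[ by exact: measurable_itv.
have M0 : 0 <= M.
  have := fM 0 1 ler01; rewrite subr0 mulr1; exact: le_trans.
split.
  apply: (@bounded_Loo _ _ (M * (c - a))) => [i|x i]; first exact: continuous_measurable_on.
  rewrite /= in_itv/= => /andP[ax xc]; apply: le_trans (coord_norm_le _ _) _.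
  have := fM a x (ltW ax); rewrite fa subr0 => /le_trans; apply.
  by apply: ler_wpM2l => //; lra.
exists g => //; apply: (@bounded_Loo _ _ M) => [i|x i _]; last exact: gM.
exact: measurable_funTS.
Qed.

End lipschitz_sobolev.

Lemma ess_sup_on_le (R : realType) (U : set R) (f g : R -> R) :
  (forall t, {ae @lebesgue_measure R, forall x, U x -> g x <= t} ->
     {ae @lebesgue_measure R, forall x, U x -> f x <= t}) ->
  (ess_sup_on U (EFin \o f) <= ess_sup_on U (EFin \o g))%E.
Proof.
move=> fg; rewrite /ess_sup_on.
have := @ess_sup_ge _ _ _ (@lebesgue_measure R) (patch (cst -oo%E) U (EFin \o g)).
case: (ess_sup (@lebesgue_measure R) (patch (cst -oo%E) U (EFin \o g))) => [t| |] H.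
- have /fg Ht : {ae @lebesgue_measure R, forall x, U x -> g x <= t}.
    apply: ae_imply H => x + Ux; rewrite /patch ifT; last by rewrite inE.
    by rewrite lee_fin.
  apply/ess_supP; apply: ae_imply Ht => x H'.
  rewrite /patch; case: ifPn => [|_]; last exact: leNye.
  by rewrite inE => Ux; rewrite lee_fin; exact: H'.
- exact: leey.
(* A value [-oo] forces [U] to be null, as [g] is real-valued. *)
- by apply/ess_supP; apply: ae_imply H => x; rewrite /patch; case: ifPn.
Qed.

(** * Absolute minimality for the supremal functional *)

Section absolute_minimality.
Context {R : realType} {N : nat}.
Let mu := @lebesgue_measure R.
Variables (alpha beta : R) (L : R -> 'rV[R]_N -> 'rV[R]_N -> R).
Hypothesis ab : alpha < beta.
Hypothesis HL : lagrangian (clamped alpha beta L).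

(** All slopes of [b] equal [d], so [T0] can be the maximum of the continuous function [F] on the
    closed interval. *)
Lemma clamped_affine_energy (b : R -> 'rV[R]_N) : affine_map b ->
  exists2 T0 : R, 0 <= T0 & energy_le (clamped alpha beta L) b alpha beta T0.
Proof.
move=> [c [d bE]].
have cb : continuous b.
  have -> : b = (fun x => c + x *: d) by apply/funext.
  by move=> x; apply: cvgD; [exact: cvg_cst|apply: cvgZr_tmp; exact: cvg_id].
pose F (x : R) : R := clamped alpha beta L x (b x) d.
have cF : continuous F.
  move=> x; apply: (@continuous_comp _ _ _ (fun x : R => (x, b x, d))
    (fun z : R * 'rV[R]_N * 'rV[R]_N => clamped alpha beta L z.1.1 z.1.2 z.2)).
    apply: (@cvg_pair _ _ _ _ (nbhs (x, b x)) (nbhs d) _ _ _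
      (fun y => (y, b y)) (fun=> d)); last exact: cvg_cst.
    by apply: (@cvg_pair _ _ _ _ (nbhs x) (nbhs (b x)) _ _ _ id b); [exact: cvg_id|exact: cb].
  exact: (lag_continuous HL).
have [z _ Fz] := EVT_max (ltW ab) (continuous_subspaceT cF).
exists (F z); first exact: (lag_ge0 HL).
move=> e e0; exists 1 => // s s' alphas ss' s'beta _.
have -> : slope b s s' = d.
  rewrite /slope !bE opprD addrACA subrr add0r -scalerBl scalerA mulVf ?scale1r//.
  by rewrite subr_eq0 gt_eqF.
apply: le_trans (_ : F z <= _); last by rewrite lerDl ltW.
by apply: Fz; rewrite in_itv/= alphas (le_trans (ltW ss')).
Qed.

Variables (u : R -> 'rV[R]_N) (M : R).
Hypothesis u_lip : forall s s', s <= s' -> `|u s' - u s| <= M * (s' - s).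
Hypothesis u_min : forall x y w t, alpha <= x -> x < y -> y <= beta ->
  energy_le (clamped alpha beta L) w x y t -> w x = u x -> w y = u y ->
  energy_le (clamped alpha beta L) u x y t.

(** On a component []p, r[] the continuous representative [v] of [phi] vanishes at both ends, which
    lie in the closure of [U] but not in [U]. Thus [u \+ v] has the boundary values of [u] and
    energy at most [t] on [[p, r]], and the same [t] serves every component. *)
Lemma weak_absolute_minimality U (phi g gu : R -> 'rV[R]_N) (t : R) :
  compactly_in U `]alpha, beta[ -> W1oo0 U phi ->
  weak_derivative U (u \+ phi) g -> weak_derivative U u gu ->
  {ae mu, forall x, U x -> L x ((u \+ phi) x) (g x) <= t} ->
  {ae mu, forall x, U x -> L x (u x) (gu x) <= t}.
Proof.
move=> [oU _ cU] [_ [v [vphi cv v0]]] ug ugu Lt.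
have cu : continuous u := @lipschitz_continuous _ _ u M u_lip.
have Ub y : U y -> alpha < y < beta.
  by move=> /(@subset_closure _ U) /cU; rewrite /= in_itv.
have LU x a P : U x -> clamped alpha beta L x a P = L x a P.
  by move=> /Ub /andP[ax xb]; rewrite /clamped clamp_id// !ltW.
apply: ae_open_components oU Ub _ => p r pr nUp nUr prU.
have prC : `[p, r] `<=` closure U.
  move=> x; rewrite /= in_itv/= => pxr.
  by apply: (closureS prU); apply/closure_itvoo.
have [Cp Cr] : closure U p /\ closure U r.
  by split; apply: prC; rewrite /= in_itv/= lexx ltW.
have /andP[ap _] : alpha < p < beta by have := cU _ Cp; rewrite /= in_itv.
have /andP[_ rb] : alpha < r < beta by have := cU _ Cr; rewrite /= in_itv.
have Ew : energy_le (clamped alpha beta L) (u \+ v) p r t.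
  apply: (ae_energy_le HL pr prU ug).
  - by apply: ae_imply vphi => x H /H /= ->.
  - move=> x; apply: cvgD; first exact: continuous_subspaceT.
    exact: (continuous_subspaceW prC cv).
  - by apply: ae_imply Lt => x H Ux; rewrite LU//; exact: H.
have Eu : energy_le (clamped alpha beta L) u p r t.
  by apply: (u_min (ltW ap) pr (ltW rb) Ew); rewrite /= v0 ?addr0.
apply: ae_imply (energy_le_ae HL pr prU ugu cu Eu) => z H pzr.
by rewrite -LU; [exact: H|apply: prU; rewrite /= in_itv].
Qed.

Lemma lipschitz_absolute_minimiser : absolute_minimiser L `]alpha, beta[ u.
Proof.
move=> U cU phi Wphi; have [oU _ UI] := cU.
have UI' : U `<=` `]alpha, beta[ := subset_trans (@subset_closure _ U) UI.
have wu : exists g, weak_derivative U u g.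
  have [g [ug _ _]] := lipschitz_weak_derivative ab u_lip.
  by exists g => i; apply: weak_derivative1S (ug i).
have wphi : exists g, weak_derivative U (u \+ phi) g.
  have [g ug] := wu; have [[_ [h phih _]] _] := Wphi.
  exists (g \+ h) => i.
  have uE : (fun x => (u \+ phi) x 0 i) = (fun x => u x 0 i) \+ (fun x => phi x 0 i).
    by apply/funext => x; rewrite /= mxE.
  have gE : (fun x => (g \+ h) x 0 i) = (fun x => g x 0 i) \+ (fun x => h x 0 i).
    by apply/funext => x; rewrite /= mxE.
  have := weak_derivative1D (ug i) (phih i).
  by rewrite -uE -gE.
(* [Dw] falls back to 0 when no weak derivative exists; [wu] and [wphi] ensure genuine ones. *)
have DuP := xgetPex (cst 0) wu; have DwP := xgetPex (cst 0) wphi.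
apply: ess_sup_on_le => t Lt.
exact: (weak_absolute_minimality cU Wphi DwP DuP Lt).
Qed.

End absolute_minimality.

Theorem theorem1 (R : realType) (N : nat) (hN : (1 <= N)%N)
    (alpha beta : R) (hab : alpha < beta)
    (L : R -> 'rV[R]_N -> 'rV[R]_N -> R)
    (L_ge0 : forall x eta P, closure `]alpha, beta[ x -> 0 <= L x eta P)
    (L_cont : {within closure `]alpha, beta[ `*` [set: 'rV[R]_N]
                        `*` [set: 'rV[R]_N],
                continuous (fun z : R * 'rV[R]_N * 'rV[R]_N =>
                              L z.1.1 z.1.2 z.2)})
    (L_lconvex : forall x eta, closure `]alpha, beta[ x ->
                   level_convex (L x eta))
    (L_growth : exists C1 C2 C3 q r : R, exists h : R * 'rV[R]_N -> R,
        [/\ [/\ 0 < C1, 0 <= C2 & 0 <= C3],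
            0 < q /\ q <= r,
            forall z, 0 <= h z,
            locally_bounded h &
            forall x eta P, closure `]alpha, beta[ x ->
              C1 * eucl_norm P `^ q - C2 <= L x eta P /\
              L x eta P <= h (x, eta) * eucl_norm P `^ r + C3]) :
  forall b : R -> 'rV[R]_N, affine_map b ->
  exists2 uinf : R -> 'rV[R]_N,
    W1oo_bd b `]alpha, beta[ uinf &
    absolute_minimiser L `]alpha, beta[ uinf.
Proof.
move=> b affb.
have [C1 [C2 [C3 [q [r [h [[C1_gt0 _ _] [q_gt0 _] _ _ grow]]]]]]] := L_growth.
have HL : lagrangian (clamped alpha beta L).
  apply: (clamped_lagrangian hab L_ge0 L_cont L_lconvex C1_gt0 q_gt0 (C2 := C2)).
  by move=> x eta P /(grow x eta P)[].
have [T0 T0_ge0 bT0] := clamped_affine_energy hab HL affb.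
have [u [M [_ [ua ub ulip _ umin]]]] :=
  energy_absolute_minimiser HL (@rV_ball_compact R N) hab T0_ge0 bT0.
exists u; last by apply: (lipschitz_absolute_minimiser hab HL ulip); exact: umin.
have [c [d bE]] := affb.
(* This difference vanishes at both ends and is Lipschitz, the affine map [b] contributing the norm
   of [d] to the constant. *)
exists (fun x => u x - b x); last by apply/funext => x; rewrite /= addrC subrK.
apply: (@lipschitz_W1oo0 _ _ _ (M + `|d|)) => //; last 2 first.
- by rewrite ua subrr.
- by rewrite ub subrr.
move=> s s' ss'.
have -> : u s' - b s' - (u s - b s) = (u s' - u s) - (s' - s) *: d.
  have <- : b s' - b s = (s' - s) *: d.
    by rewrite !bE opprD addrACA subrr add0r -scalerBl.
  by rewrite !opprD !opprK addrACA.
apply: le_trans (ler_normB _ _) _; rewrite mulrDl lerD//; first exact: ulip.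
by rewrite normrZ ger0_norm ?subr_ge0// mulrC.
Qed.
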